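(* Let $\lambda>0$, let $c_k\in(0,1)$ for $k\ge1$, let $l_k=e^{-\lambda k}$, let $I_k$ be the open interval of length $l_k$ centered at $c_k$, and let $S=\bigcap_{m\ge1}\bigcup_{k\ge m}I_k$. Assume that assumptions (A1), (A2), (A3) below hold. Then $\mathrm{Cap}(S)=\mathrm{Cap}([0,1])>0$.
   Context: Interaction: $I(\nu,\mu)=\iint(-\log|z-w|)\,d\nu(z)\,d\mu(w)$, energy $I(\mu)=I(\mu,\mu)$; capacity $\mathrm{Cap}(E)=\exp(-\inf I(\mu))$, the infimum over Borel probability measures with compact support contained in $E$ ($e^{-\infty}=0$). Notation: $\mathcal{A}_n=\{n,\dots,2n-1\}$ and, for $q\in\mathbb{N}$, $\mathcal{A}_{n,q}=\mathcal{A}_n\cup\mathcal{A}_{2n}\cup\cdots\cup\mathcal{A}_{2^q n}$. (A1) There is $\phi\in L^1([0,1],dx)$ with $\phi>0$ a.e. such that for every $f\in C([0,1])$, $\frac{1}{\#\mathcal{A}_n}\sum_{k\in\mathcal{A}_n}f(c_k)\to\int_0^1 f(x)\phi(x)\,dx$ as $n\to\infty$. Moreover there is a sequence of integers $q(n)\to\infty$ such that: (A2) for every $\varepsilon>0$ there is $\delta>0$ such that for all sufficiently large $n$ and all $n',n''\in\{n,2n,\dots,2^{q(n)}n\}$, $\frac{1}{\#(\mathcal{A}_{n'}\times\mathcal{A}_{n''})}\sum(-\log|c_i-c_j|)<\varepsilon$, the sum over $i\in\mathcal{A}_{n'}$, $j\in\mathcal{A}_{n''}$ with $i\ne j$ and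 $|c_i-c_j|<\delta$; (A3) for every $\varepsilon>0$, for all sufficiently large $n$ and all $i\ne j$ in $\mathcal{A}_{n,q(n)}$, $\frac{l_i+l_j}{2|c_i-c_j|}<\varepsilon$. *)

(* Defs.v *)
From HB Require Import structures.
From mathcomp Require Import all_boot all_order all_algebra.
From mathcomp Require Import all_classical all_reals all_analysis.
Set Implicit Arguments. Unset Strict Implicit. Unset Printing Implicit Defensive.
Import Order.TTheory GRing.Theory Num.Theory.
Import numFieldNormedType.Exports.
Local Open Scope classical_set_scope.
Local Open Scope ring_scope.

Definition logk (R : realType) (z w : R) : \bar R :=
  if z == w then +oo%E else (- ln `|z - w|)%:E.

Definition interaction (R : realType) (nu mu : probability R R) : \bar R :=
  (\int[mu]_w (\int[nu]_z logk z w))%E.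

Definition energy (R : realType) (mu : probability R R) : \bar R :=
  interaction mu mu.

(* mu is a Borel probability measure whose support is compact and contained
   in E, i.e. mu is carried by a compact subset of E. *)
Definition compactly_supported_in (R : realType) (E : set R)
  (mu : probability R R) : Prop :=
  exists K : set R, [/\ compact K, K `<=` E & mu (~` K) = 0%E].

Definition capacity (R : realType) (E : set R) : \bar R :=
  match ereal_inf [set energy mu | mu in [set mu | compactly_supported_in E mu]]
  with
  | r%:E => (expR (- r))%:E
  | +oo%E => 0%E
  | -oo%E => +oo%E
  end.

Definition inA (n i : nat) : Prop := (n <= i < 2 * n)%N.
Definition inAq (n q i : nat) : Prop := exists a : nat, (a <= q)%N /\ inA (2 ^ a * n) i.
Definition dyadic_scale (n q n' : nat) : Prop := exists a : nat, (a <= q)%N /\ n' = (2 ^ a * n)%N.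

Definition len (R : realType) (lambda : R) (k : nat) : R := expR (- (lambda * k%:R)).

Definition limsup_set (R : realType) (lambda : R) (c : nat -> R) : set R :=
  \bigcap_(m in [set m : nat | (1 <= m)%N])
    \bigcup_(k in [set k : nat | (m <= k)%N])
      `](c k - len lambda k / 2), (c k + len lambda k / 2)[%classic.

Definition assumption_A1 (R : realType) (c : nat -> R) : Prop :=
  exists phi : R -> R,
    [/\ (lebesgue_measure : set R -> \bar R).-integrable `[0, 1] (EFin \o phi),
        {ae (lebesgue_measure : set R -> \bar R), forall x, `[0, 1]%classic x -> 0 < phi x} &
        forall f : R -> R, {within `[0, 1], continuous f} ->
          ((n%:R)^-1 * \sum_(n <= k < 2 * n) f (c k)) @[n --> \oo] -->
            Rintegral lebesgue_measure `[0, 1] (fun x => f x * phi x)].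

Definition assumption_A2 (R : realType) (c : nat -> R) (q : nat -> nat) : Prop :=
  forall eps : R, 0 < eps -> exists2 delta : R, 0 < delta &
    exists N : nat, forall n, (N <= n)%N -> forall n' n'',
      dyadic_scale n (q n) n' -> dyadic_scale n (q n) n'' ->
      ((((n' * n'')%:R)^-1)%:E *
        (\sum_(n' <= i < 2 * n') \sum_(n'' <= j < 2 * n'' | (i != j) && (`|c i - c j| < delta)%R)
           logk (c i) (c j)) < eps%:E)%E.

(* (A3) : the ratio (l_i + l_j)/(2|c_i - c_j|) (which is +oo when c_i = c_j)
   is < eps *)
Definition assumption_A3 (R : realType) (lambda : R) (c : nat -> R) (q : nat -> nat) : Prop :=
  forall eps : R, 0 < eps -> exists N : nat, forall n, (N <= n)%N ->
    forall i j, inAq n (q n) i -> inAq n (q n) j -> i <> j ->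
      c i != c j /\ (len lambda i + len lambda j) / (2 * `|c i - c j|) < eps.

(* Main.v *)
(** A probability measure on [0,1] is approximated by a finite cluster of
    disjoint weighted balls. The energy of a cluster charges a pair of distinct
    balls the maximum of log(1/|x - y|) over them and a single ball of radius r
    the amount 10 - log r.

    Inside any ball of radius r, (A1)-(A3) provide, for n large, a cluster made
    of the intervals I_j, j in A_{n,q(n)}, shrunk by a factor 2, of energy at
    most 10 - log r: mass is spread evenly over the q(n)+1 levels A_{2^a n}, and
    within a level so as to imitate a bounded multiple of phi dx. Self-energies
    contribute O(1/q(n)) because log(1/l_j) = lambda j; near pairs are handled
    by (A2), far pairs by comparison with Lebesgue measure, and (A3) replaces
    centers by intervals. Grafting such clusters into the balls of a given
    cluster therefore does not increase the energy. Iterating yields nested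
    clusters whose masses define the distribution function of a measure carried
    by a compact subset of S; by Fatou its energy is at most that of the first
    cluster, and the first cluster can be taken on a fine grid with energy
    arbitrarily close to that of any given measure on [0,1]. *)
Require Import Defs.
From HB Require Import structures.
From mathcomp Require Import all_boot all_order all_algebra.
From mathcomp Require Import all_classical all_reals all_analysis.
From mathcomp Require Import measurable_realfun ring lra zify.
Import Order.TTheory GRing.Theory Num.Theory.
Import numFieldNormedType.Exports.
Local Open Scope classical_set_scope.
Local Open Scope ring_scope.

(** * Clusters of balls *)

(** Strict separation keeps the argument of the logarithm in [pair_energy] positive, and containment
    in [0,1] makes every pair energy nonnegative. *)
Record cluster (R : realType) := Cluster {
  idx : finType;
  ctr : idx -> R;
  rad : idx -> R;
  wt : idx -> R;
  wt_gt0 : forall i, 0 < wt i;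
  wt_sum : \sum_i wt i = 1;
  rad_gt0 : forall i, 0 < rad i;
  left_ge0 : forall i, 0 <= ctr i - rad i;
  right_le1 : forall i, ctr i + rad i <= 1;
  separated : forall i j, i != j -> rad i + rad j < `|ctr i - ctr j| }.

Arguments idx {R}.
Arguments ctr {R} c _.
Arguments rad {R} c _.
Arguments wt {R} c _.

(* Off the diagonal this is the largest value of -log|x - y| over the two
   balls; the constant 10 on the diagonal is what makes [exists_subcluster]
   and [graft] fit together. *)
Definition pair_energy {R : realType} {I : finType} (b r : I -> R) (i j : I) : R :=
  if i == j then 10 - ln (r i) else - ln (`|b i - b j| - r i - r j).

Definition cenergy {R : realType} (s : cluster R) : R :=
  \sum_i \sum_j wt s i * wt s j * pair_energy (ctr s) (rad s) i j.

Lemma ler_Nln {R : realType} (x y : R) : 0 < x -> x <= y -> - ln y <= - ln x.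
Proof. by move=> x0 xy; rewrite lerN2 ler_ln// posrE (lt_le_trans x0). Qed.

Lemma pair_energy_ge0 {R : realType} (s : cluster R) (i j : idx s) :
  0 <= pair_energy (ctr s) (rad s) i j.
Proof.
have := (rad_gt0 R s i, rad_gt0 R s j, left_ge0 R s i, left_ge0 R s j,
         right_le1 R s i, right_le1 R s j).
move=> [[[[[ri rj] li] lj] hi] hj].
rewrite /pair_energy; case: ifPn => [_|ij].
  have : ln (rad s i) <= 0 by apply: ln_le0; lra.
  by lra.
rewrite oppr_ge0 ln_le0//.
have : `|ctr s i - ctr s j| <= 1 by rewrite ler_norml; apply/andP; split; lra.
by lra.
Qed.

(** Indices of weight zero are discarded, so the geometric conditions are required only where the
    weight is positive; the energy sum does not see the discarded terms. *)
Lemma cluster_of_weights {R : realType} (I : finType) (b r w : I -> R) :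
  (forall i, 0 <= w i) -> \sum_i w i = 1 ->
  (forall i, 0 < w i -> [/\ 0 < r i, 0 <= b i - r i & b i + r i <= 1]) ->
  (forall i j, 0 < w i -> 0 < w j -> i != j -> r i + r j < `|b i - b j|) ->
  exists s : cluster R,
    (forall k : idx s, exists i, [/\ 0 < w i, ctr s k = b i & rad s k = r i]) /\
    cenergy s = \sum_i \sum_j w i * w j * pair_energy b r i j.
Proof.
move=> w0 w1 wb ws.
pose A := [pred i | 0 < w i].
have sumA (F : I -> R) : (forall i, w i = 0 -> F i = 0) ->
    \sum_i F i = \sum_(x : {x in A}) F (val x).
  move=> F0; transitivity (\sum_(i in A) F i); last exact: big_sub.
  rewrite [RHS]big_mkcond/=; apply: eq_bigr => i _.
  rewrite inE; case: ifPn => //; rewrite -leNgt => wi; apply: F0.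
  by apply/eqP; rewrite eq_le wi w0.
have wA (x : {x in A}) : 0 < w (val x) by exact: (valP x).
have sepA (x y : {x in A}) : x != y -> r (val x) + r (val y) < `|b (val x) - b (val y)|.
  by move=> xy; apply: ws.
have sA : \sum_(x : {x in A}) w (val x) = 1 by rewrite -sumA.
unshelve eexists (@Cluster R {x in A} (fun x => b (val x)) (fun x => r (val x))
   (fun x => w (val x)) wA sA _ _ _ sepA); rewrite /=.
- by move=> x; have [] := wb _ (wA x).
- by move=> x; have [] := wb _ (wA x).
- by move=> x; have [] := wb _ (wA x).
split=> [k|]; first by exists (val k).
rewrite /cenergy /= [RHS]sumA; last first.
  by move=> i wi0; rewrite big1// => j _; rewrite wi0 !mul0r.
apply: eq_bigr => x _; rewrite [RHS]sumA; last by move=> j wj0; rewrite wj0 mulr0 mul0r.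
by apply: eq_bigr => y _; rewrite /pair_energy (inj_eq val_inj).
Qed.

Definition inside {R : realType} (s : cluster R) (l h : R) :=
  forall k, l < ctr s k - rad s k /\ ctr s k + rad s k < h.

(** The strict inclusion on the left matters in [refines_cdf_lft]: no child begins at the left
    endpoint of its parent. *)
Record refines {R : realType} (s t : cluster R) (p : idx t -> idx s) : Prop := {
  ref_left : forall k, ctr s (p k) - rad s (p k) < ctr t k - rad t k;
  ref_right : forall k, ctr t k + rad t k < ctr s (p k) + rad s (p k);
  ref_wt : forall i, \sum_(k | p k == i) wt t k = wt s i }.

Arguments refines {R s t} p.
Arguments ref_left {R s t p}.
Arguments ref_right {R s t p}.
Arguments ref_wt {R s t p}.

(** For disjoint balls, [|b - b'| - r - r'] is the least distance between their points, which can
    only grow when both are replaced by sub-balls. *)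
Lemma sub_balls_dist {R : realType} (b r b' r' x s x' s' : R) :
  b - r < x - s -> x + s < b + r -> b' - r' < x' - s' -> x' + s' < b' + r' ->
  `|b - b'| - r - r' <= `|x - x'| - s - s'.
Proof.
move=> h1 h2 h3 h4; case: (ger0P (b - b')) => bb; case: (ger0P (x - x')) => xx; lra.
Qed.

(** For two distinct parents, the children are at least as far apart as the parents, so the averaged
    pair energy does not grow. The diagonal term of a parent, its squared weight times [10 - ln r],
    pays for the whole energy of the cluster placed in it. *)
Lemma graft {R : realType} (s : cluster R) (ch : idx s -> cluster R) :
  (forall i, inside (ch i) (ctr s i - rad s i) (ctr s i + rad s i)) ->
  (forall i, cenergy (ch i) <= 10 - ln (rad s i)) ->
  exists (t : cluster R) (p : idx t -> idx s),
    [/\ refines p, cenergy t <= cenergy s &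
        forall k, exists i (k' : idx (ch i)), ctr t k = ctr (ch i) k' /\ rad t k = rad (ch i) k'].
Proof.
move=> ins en.
pose J := {i : idx s & idx (ch i)}.
pose b (x : J) := ctr (ch (tag x)) (tagged x).
pose r (x : J) := rad (ch (tag x)) (tagged x).
pose w (x : J) := wt s (tag x) * wt (ch (tag x)) (tagged x).
have sumJ (F : forall i, idx (ch i) -> R) :
    \sum_(x : J) F (tag x) (tagged x) = \sum_i \sum_k F i k.
  by rewrite sig_big_dep.
have w_gt0 x : 0 < w x by rewrite mulr_gt0// wt_gt0.
have w_sum : \sum_x w x = 1.
  rewrite (sumJ (fun i k => wt s i * wt (ch i) k)) -[RHS](wt_sum R s).
  by apply: eq_bigr => i _; rewrite -mulr_sumr wt_sum mulr1.
have dist x y :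
    `|ctr s (tag x) - ctr s (tag y)| - rad s (tag x) - rad s (tag y) <= `|b x - b y| - r x - r y.
  by apply: sub_balls_dist; have [] := ins (tag x) (tagged x);
     have [] := ins (tag y) (tagged y).
have sep x y : x != y -> r x + r y < `|b x - b y|.
  have [/eqP|txy] := boolP (tag x == tag y); last first.
    by move=> _; have := dist x y; have := separated R s _ _ txy; lra.
  case: x y => [i k] [i' k'] /= ii'; subst i' => kk'.
  by apply: (separated R (ch i)); move: kk'; rewrite eq_Tagged.
unshelve eexists (@Cluster R J b r w w_gt0 w_sum _ _ _ sep).
- by move=> x; apply: rad_gt0.
- by move=> x; apply: left_ge0.
- by move=> x; apply: right_le1.
exists (@tag _ _); split => /=.
- split=> /= [k|k|i]; first by have [] := ins (tag k) (tagged k).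
    by have [] := ins (tag k) (tagged k).
  rewrite big_mkcond (sumJ (fun i' k => if i' == i then wt s i' * wt (ch i') k else 0)).
  rewrite (bigD1 i)//= eqxx -mulr_sumr wt_sum mulr1 big1 ?addr0// => j /negPf ->.
  by rewrite big1.
- rewrite /cenergy /=.
  pose G i k j l := w (Tagged (fun i => idx (ch i)) (k : idx (ch i))) *
     w (Tagged (fun i => idx (ch i)) (l : idx (ch j))) *
     pair_energy b r (Tagged (fun i => idx (ch i)) k) (Tagged (fun i => idx (ch i)) l).
  have -> : \sum_(x : J) \sum_(y : J) w x * w y * pair_energy b r x y =
      \sum_i \sum_j \sum_(k : idx (ch i)) \sum_(l : idx (ch j)) G i k j l.
    under [RHS]eq_bigr do rewrite exchange_big.
    rewrite -(sumJ (fun i k => \sum_j \sum_l G i k j l)); apply: eq_bigr => -[i k] _ /=.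
    by rewrite -(sumJ (fun j l => G i k j l)); apply: eq_bigr => -[j l] _.
  apply: ler_sum => i _; apply: ler_sum => j _.
  have [->|ij] := eqVneq i j.
    rewrite [X in _ <= _ * X]/pair_energy eqxx.
    apply: le_trans (_ : wt s j * wt s j * cenergy (ch j) <= _); last first.
      by rewrite ler_wpM2l// mulr_ge0// ltW// wt_gt0.
    rewrite /cenergy mulr_sumr ler_sum// => k _; rewrite mulr_sumr ler_sum// => l _.
    rewrite /G /w /= [pair_energy b r _ _](_ : _ = pair_energy (ctr (ch j)) (rad (ch j)) k l).
      by rewrite le_eqVlt; apply/orP; left; apply/eqP; ring.
    by rewrite /pair_energy eq_Tagged.
  (* The parent term is spread over all pairs of children, whose weights sum to one, so that the
     comparison becomes termwise. *)
  have -> : wt s i * wt s j * pair_energy (ctr s) (rad s) i j =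
      \sum_k \sum_l wt s i * wt (ch i) k * (wt s j * wt (ch j) l) * pair_energy (ctr s) (rad s) i j.
    under eq_bigr do rewrite -mulr_suml -mulr_sumr -mulr_sumr wt_sum mulr1.
    by rewrite -!mulr_suml -mulr_sumr wt_sum mulr1.
  apply: ler_sum => k _; apply: ler_sum => l _; rewrite ler_wpM2l//.
    by rewrite mulr_ge0// ltW// w_gt0.
  rewrite /pair_energy (negPf ij) ifF; last first.
    by apply/eqP => /(congr1 (@tag _ _)) /= /eqP; rewrite (negPf ij).
  apply: ler_Nln; first by have := separated R s _ _ ij; lra.
  exact: (dist (Tagged (fun i => idx (ch i)) k) (Tagged (fun i => idx (ch i)) l)).
- by move=> [i k]; exists i, k.
Qed.

(** * Logarithmic sums and cells *)

Lemma ln_le_subr1 {R : realType} (x : R) : 0 < x -> ln x <= x - 1.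
Proof. by move=> x0; have := @le_ln1Dx R (x - 1); rewrite addrCA subrr addr0; apply; lra. Qed.

(* This is M^M / M! <= e^M, in logarithms. *)
Lemma sum_ln_ratio {R : realType} (M : nat) :
  \sum_(k < M) (ln M%:R - ln k.+1%:R) <= M%:R :> R.
Proof.
elim: M => [|M IH]; first by rewrite big_ord0.
rewrite big_ord_recr /= subrr addr0.
have [->|M0] := posnP M; first by rewrite big_ord0.
have M0' : 0 < M%:R :> R by rewrite ltr0n.
(* Passing from M to M+1 adds M times ln(1 + 1/M), which is at most 1. *)
rewrite (eq_bigr (fun k : 'I_M => (ln M%:R - ln k.+1%:R) + (ln M.+1%:R - ln M%:R))); last first.
  by move=> k _; ring.
rewrite big_split/= sumr_const card_ord -[M.+1 in leRHS]addn1 natrD lerD//.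
rewrite -ln_div ?posrE ?ltr0n// -[X in X <= _]mulr_natr.
have -> : M.+1%:R / M%:R = 1 + M%:R^-1 :> R by rewrite -natr1; field; rewrite gt_eqF.
have := @ln_le_subr1 R (1 + M%:R^-1); rewrite addrAC subrr add0r => h.
apply: le_trans (_ : M%:R^-1 * M%:R <= _); last by rewrite mulVf// gt_eqF.
by rewrite ler_wpM2r// h// ltr_pwDl// invr_ge0.
Qed.

(** Truncated subtraction annihilates one of the two terms, so this is |u - v|. *)
Definition ndist (u v : nat) : nat := (u - v) + (v - u).

Lemma ln_ndist_ge0 {R : realType} (M u v : nat) : (u < M)%N -> (v < M)%N ->
  0 <= ln M%:R - ln (maxn 1 (ndist u v))%:R :> R.
Proof.
move=> uM vM; rewrite subr_ge0 ler_ln ?posrE ?ltr0n ?ler_nat; rewrite /ndist; lia.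
Qed.

(** The indices below u, the index u itself and those above u contribute at most M each: the two
    sides by [sum_ln_ratio], the middle because ln M is at most M. *)
Lemma sum_ln_ndist {R : realType} (M u : nat) : (u < M)%N ->
  \sum_(v < M) (ln M%:R - ln (maxn 1 (ndist u v))%:R) <= 3 * M%:R :> R.
Proof.
move=> uM; pose f k : R := ln M%:R - ln k%:R.
have M0 : 0 < M%:R :> R by rewrite ltr0n; lia.
have f0 k : (k < M)%N -> 0 <= f k.+1.
  by move=> kM; rewrite subr_ge0 ler_ln ?posrE// ?ltr0n// ler_nat.
have S p : (p <= M)%N -> \sum_(0 <= k < p) f k.+1 <= M%:R.
  move=> pM; apply: le_trans (sum_ln_ratio M).
  rewrite -(big_mkord xpredT (fun k => f k.+1)) (big_cat_nat (n := p) _ pM)//=.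
  rewrite lerDl big_nat_cond sumr_ge0// => i /andP[/andP[_ iM] _]; exact: f0.
rewrite -(big_mkord xpredT (fun v => f (maxn 1 (ndist u v)))).
rewrite (big_cat_nat (n := u) _ (ltnW uM))//= (big_cat_nat (n := u.+1) _ uM)//= big_nat1.
have -> : 3 * M%:R = M%:R + (M%:R + M%:R) :> R by ring.
rewrite lerD//; last rewrite lerD//.
- apply: le_trans (S u (ltnW uM)); rewrite big_nat_rev/= le_eqVlt; apply/orP; left; apply/eqP.
  by apply: eq_big_nat => i iu; congr f; rewrite /ndist; lia.
- rewrite /f (_ : maxn 1 (ndist u u) = 1%N) ?mulr1n ?ln1 ?subr0; last by rewrite /ndist; lia.
  by have := ln_le_subr1 _ M0; lra.
- apply: le_trans (S (M - u.+1)%N (leq_subr _ _)).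
  rewrite -{1}[u.+1]add0n big_addn le_eqVlt; apply/orP; left; apply/eqP.
  by apply: eq_big_nat => i iu; congr f; rewrite /ndist; lia.
Qed.

Lemma len_gt0 {R : realType} (lambda : R) k : 0 < len lambda k.
Proof. exact: expR_gt0. Qed.

Lemma len_cvg0 {R : realType} (lambda e : R) : 0 < lambda -> 0 < e ->
  exists N, forall k, (N <= k)%N -> len lambda k < e.
Proof.
(* Beyond this index lambda k exceeds 1/e, and exp(x) >= 1 + x concludes. *)
move=> l0 e0; exists (Num.truncn (1 / (lambda * e))).+1 => k Nk.
have : 1 / (lambda * e) < k%:R.
  apply: lt_le_trans (truncnS_gt _) _; by rewrite ler_nat.
rewrite ltr_pdivrMr ?mulr_gt0// => h.
have := expR_ge1Dx (lambda * k%:R) => h2.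
rewrite /len expRN -[ltRHS]invrK ltf_pV2 ?posrE ?expR_gt0 ?invr_gt0//.
apply: lt_le_trans h2; apply: lt_le_trans (_ : lambda * k%:R <= _); last by lra.
by rewrite -(ltr_pM2r e0) mulVf ?gt_eqF//; lra.
Qed.

(** The cells divide only the concentric interval of half the radius; the remaining margin r/2 keeps
    the small intervals centered in a cell inside the ball of radius r. *)
Definition incell {R : realType} (b r : R) (M u : nat) (x : R) : bool :=
  (b - r / 2 + u%:R * (r / M%:R) < x) && (x < b - r / 2 + u.+1%:R * (r / M%:R)).

Lemma incell_inj {R : realType} (b r : R) (M u v : nat) (x : R) : 0 < r ->
  incell b r M u x -> incell b r M v x -> u = v.
Proof.
move=> r0; have e0 : 0 <= r / M%:R by rewrite divr_ge0// ltW.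
wlog uv : u v / (u < v)%N => [H h1 h2|/andP[_ h1] /andP[h2 _]].
  by have [uv|vu|//] := ltngtP u v; [|symmetry]; apply: H.
have : u.+1%:R * (r / M%:R) <= v%:R * (r / M%:R) :> R by rewrite ler_wpM2r// ler_nat.
by move=> h; exfalso; lra.
Qed.

Lemma incell_dist {R : realType} (b r : R) (M u v : nat) (x y : R) : 0 < r ->
  incell b r M u x -> incell b r M v y ->
  ((ndist u v)%:R - 1) * (r / M%:R) < `|x - y| < ((ndist u v)%:R + 1) * (r / M%:R).
Proof.
move=> r0; have e0 : 0 <= r / M%:R by rewrite divr_ge0// ltW.
wlog uv : u v x y / (u <= v)%N => [H h1 h2|].
  have [uv|vu] := leqP u v; first exact: H.
  by rewrite distrC (_ : ndist u v = ndist v u) ?H// 1?ltnW// /ndist addnC.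
move=> /andP[h1 h2] /andP[h3 h4].
have -> : ndist u v = (v - u)%N by rewrite /ndist; lia.
rewrite natrB//; move: h2 h4; rewrite -[u.+1%:R]natr1 -[v.+1%:R]natr1; set e := r / M%:R in e0 h1 h3 *.
set U : R := u%:R in h1 *; set V : R := v%:R in h3 *.
move=> h2 h4; have : U * e <= V * e by rewrite ler_wpM2r// ler_nat.
by case: (ger0P (x - y)) => xy h5; apply/andP; split; lra.
Qed.

Lemma incell_itv {R : realType} (b r : R) (M u : nat) (x : R) : 0 < r -> (u < M)%N ->
  incell b r M u x -> b - r / 2 < x < b + r / 2.
Proof.
move=> r0 uM /andP[h1 h2].
have M0 : 0 < M%:R :> R by rewrite ltr0n; lia.
have e0 : 0 <= r / M%:R by rewrite divr_ge0// ltW.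
have : 0 <= u%:R * (r / M%:R) by rewrite mulr_ge0.
have : u.+1%:R * (r / M%:R) <= M%:R * (r / M%:R) by rewrite ler_wpM2r// ler_nat.
have -> : M%:R * (r / M%:R) = r by field; rewrite gt_eqF.
by lra.
Qed.

Lemma sum_incell_le1 {R : realType} (b r : R) (M : nat) (x : R) : 0 < r ->
  \sum_(u < M) (incell b r M u x)%:R <= 1 :> R.
Proof.
move=> r0; have [u hu|h] := pickP (fun u : 'I_M => incell b r M u x); last first.
  by rewrite big1// => u _; rewrite h.
rewrite (bigD1 u)//= hu big1 ?addr0// => v vu.
by case: (boolP (incell _ _ _ _ _)) => // /(incell_inj _ _ _ _ _ _ r0 hu)/ord_inj uv; rewrite uv eqxx in vu.
Qed.

(* If two distinct points in cells u, v are at least four cell widths apart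
   then |u - v| >= 3, hence |x - y| >= |u - v| (r/M) / 2. *)
Lemma far_cells {R : realType} (b r d : R) (M u v : nat) (x y : R) : 0 < r -> (0 < M)%N ->
  incell b r M u x -> incell b r M v y -> 4 * (r / M%:R) <= d -> d <= `|x - y| ->
  - ln `|x - y| <= ln 2 - ln r + (ln M%:R - ln (maxn 1 (ndist u v))%:R).
Proof.
move=> r0 M0 hu hv hd hxy; have /andP[h1 h2] := incell_dist _ _ _ _ _ _ _ r0 hu hv.
have M0' : 0 < M%:R :> R by rewrite ltr0n.
have e0 : 0 < r / M%:R by rewrite divr_gt0.
have h3 : 4 * (r / M%:R) < ((ndist u v)%:R + 1) * (r / M%:R) by lra.
rewrite ltr_pM2r// in h3.
have h4 : (3 < (ndist u v)%:R :> R) by lra.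
have h5 : (3 < ndist u v)%N by rewrite -(ltr_nat R).
rewrite (_ : maxn 1 _ = ndist u v); last by lia.
set D : R := (ndist u v)%:R in h1 h2 h3 h4 *.
have -> : ln 2 - ln r + (ln M%:R - ln D) = - ln (D * (r / M%:R) / 2).
  have D0 : 0 < D by lra.
  have -> : ln (D * (r / M%:R) / 2) = ln D + (ln r - ln M%:R) - ln 2.
    have m1 : 0 < D * (r / M%:R) by exact: mulr_gt0.
    by rewrite ln_div ?posrE// lnM ?posrE// ln_div ?posrE.
  by ring.
by apply: ler_Nln; nra.
Qed.

(** * Points of the levels *)

(** The pair (a, e) encodes the integer 2^a n + e of the level A_{2^a n}. *)
Definition level_index (q n : nat) : finType := {a : 'I_q.+1 & 'I_(2 ^ a * n)}.

Definition lev {q n} (h : level_index q n) : nat := 2 ^ tag h * n.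
Definition pos {q n} (h : level_index q n) : nat := lev h + tagged h.

Lemma pos_bounds {q n} (h : level_index q n) : (lev h <= pos h < 2 * lev h)%N.
Proof. by rewrite /pos; have := ltn_ord (tagged h); rewrite -/(lev h); lia. Qed.

Lemma pos_inAq {q n} (h : level_index q n) : inAq n q (pos h).
Proof.
exists (tag h); split; first by rewrite -ltnS.
exact: pos_bounds.
Qed.

(** Distinct levels are disjoint because each ends before the double of its first element. *)
Lemma pos_inj {q n} : injective (@pos q n).
Proof.
have lt_pos (g h : level_index q n) : (tag g < tag h)%N -> (pos g < pos h)%N.
  move=> gh; have /andP[_ h1] := pos_bounds g; have /andP[h2 _] := pos_bounds h.
  apply: leq_trans h1 (leq_trans _ h2); rewrite /lev mulnA -expnS leq_mul2r.
  by rewrite leq_exp2l// gh orbT.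
move=> g h gh; have [tgh|tgh|/ord_inj tgh] := ltngtP (tag g) (tag h).
- by have := lt_pos _ _ tgh; rewrite gh ltnn.
- by have := lt_pos _ _ tgh; rewrite gh ltnn.
case: g h tgh gh => [a e] [a' e'] /= aa'; subst a' => /eqP.
by rewrite /pos /lev /= eqn_add2l => /eqP/ord_inj ->.
Qed.

Lemma sum_from_double {R : realType} (n : nat) (F : nat -> R) :
  \sum_(n <= k < 2 * n) F k = \sum_(e < n) F (e + n)%N.
Proof. by rewrite -{1}[n]add0n big_addn mul2n -addnn addnK big_mkord. Qed.

Lemma sum_levels {R : realType} (q n : nat) (F : nat -> nat -> R) :
  \sum_(h : level_index q n) F (tag h) (pos h) =
  \sum_(a < q.+1) \sum_(2 ^ a * n <= k < 2 * (2 ^ a * n)) F a k.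
Proof.
transitivity (\sum_(a < q.+1) \sum_(e < 2 ^ a * n) F a (2 ^ a * n + e)%N).
  by rewrite sig_big_dep.
apply: eq_bigr => a _; rewrite sum_from_double.
by apply: eq_bigr => e _; rewrite addnC.
Qed.

Definition near {R : realType} (c : nat -> R) (d : R) (k l : nat) : R :=
  if (k != l) && (`|c k - c l| < d) then - ln `|c k - c l| else 0.

(** This restates (A2) with real sums: the centers being distinct, [logk] takes no infinite value
    there. *)
Lemma near_sum {R : realType} (c : nat -> R) (n' n'' : nat) (d e : R) :
  (0 < n')%N -> (0 < n'')%N ->
  (forall k l, (n' <= k < 2 * n')%N -> (n'' <= l < 2 * n'')%N -> k != l -> c k != c l) ->
  ((((n' * n'')%:R^-1)%:E *
        (\sum_(n' <= i < 2 * n') \sum_(n'' <= j < 2 * n'' | (i != j) && (`|c i - c j| < d)%R)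
           logk (c i) (c j)) < e%:E)%E) ->
  \sum_(n' <= k < 2 * n') \sum_(n'' <= l < 2 * n'') near c d k l <= e * n'%:R * n''%:R.
Proof.
move=> n'0 n''0 cne.
rewrite [X in (_ * X < _)%E](_ : _ =
    (\sum_(n' <= k < 2 * n') \sum_(n'' <= l < 2 * n'') near c d k l)%:E); last first.
  rewrite -sumEFin; apply: eq_big_nat => k hk.
  rewrite -sumEFin big_mkcond; apply: eq_big_nat => l hl.
  rewrite /near; case: ifPn => // /andP[kl _]; rewrite /logk ifF//.
  by apply/negbTE/cne.
rewrite -EFinM lte_fin => h; apply/ltW; move: h.
by rewrite mulrC ltr_pdivrMr ?ltr0n ?muln_gt0 ?n'0// natrM mulrA.
Qed.

Definition cellcount {R : realType} (c : nat -> R) (b r : R) (M u n : nat) : R :=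
  \sum_(n <= k < 2 * n) (incell b r M u (c k))%:R.

Lemma cellcount_ge0 {R : realType} (c : nat -> R) (b r : R) (M u n : nat) :
  0 <= cellcount c b r M u n.
Proof. exact: sumr_ge0. Qed.

(** The mass [sg u] of a cell is divided evenly among the q+1 levels, then evenly among the points
    of each level that fall in the cell. An empty cell gives division by zero, hence weight 0. *)
Definition cell_wt {R : realType} (c : nat -> R) (b r : R) (M : nat) (sg : 'I_M -> R)
    (q n : nat) (u : 'I_M) (h : level_index q n) : R :=
  (incell b r M u (c (pos h)))%:R *
  (sg u / (q.+1%:R * cellcount c b r M u (lev h))).

Lemma cell_wt_ge0 {R : realType} (c : nat -> R) (b r : R) (M : nat) (sg : 'I_M -> R)
    (q n : nat) (u : 'I_M) (h : level_index q n) : (forall v, 0 <= sg v) ->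
  0 <= cell_wt c b r M sg q n u h.
Proof.
by move=> sg0; rewrite mulr_ge0// divr_ge0// mulr_ge0// cellcount_ge0.
Qed.

(** Since the cell holds at least [sg u / C] times as many points as the whole level, no point
    weighs more than C times its share under the uniform distribution over levels and points. *)
Lemma cell_wt_le {R : realType} (c : nat -> R) (b r C : R) (M : nat) (sg : 'I_M -> R)
    (q n : nat) (u : 'I_M) (h : level_index q n) : (0 < n)%N -> 0 < C ->
  (forall v, 0 <= sg v) ->
  sg u * (lev h)%:R <= C * cellcount c b r M u (lev h) ->
  cell_wt c b r M sg q n u h <= C / (q.+1%:R * (lev h)%:R) * (incell b r M u (c (pos h)))%:R.
Proof.
move=> n0 C0 sg0 hc; rewrite /cell_wt mulrC ler_wpM2r//.
have l0 : 0 < (lev h)%:R :> R by rewrite ltr0n muln_gt0 expn_gt0.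
have := cellcount_ge0 c b r M u (lev h); rewrite le_eqVlt => /predU1P[<-|N0].
  by rewrite mulr0 invr0 mulr0 divr_ge0 ?mulr_ge0 ?ltW.
rewrite ler_pdivrMr ?mulr_gt0// mulrAC ler_pdivlMr ?mulr_gt0//.
by rewrite mulrCA [leRHS]mulrCA ler_wpM2l// mulrC.
Qed.

Lemma cell_wt_sum {R : realType} (c : nat -> R) (b r C : R) (M : nat) (sg : 'I_M -> R)
    (q n : nat) (u : 'I_M) : (0 < n)%N -> 
  (forall v, 0 <= sg v) ->
  (forall n', (n <= n')%N -> sg u * n'%:R <= C * cellcount c b r M u n') ->
  \sum_(h : level_index q n) cell_wt c b r M sg q n u h = sg u.
Proof.
move=> n0 sg0 hc.
rewrite (sum_levels q n (fun a k => (incell b r M u (c k))%:R *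
  (sg u / (q.+1%:R * cellcount c b r M u (2 ^ a * n))))).
rewrite (eq_bigr (fun=> sg u / q.+1%:R)).
  by rewrite sumr_const card_ord -[LHS]mulr_natr mulfVK// pnatr_eq0.
move=> a _; rewrite -mulr_suml -/(cellcount c b r M u (2 ^ a * n)).
set N := cellcount _ _ _ _ _ _.
have an : (n <= 2 ^ a * n)%N by rewrite leq_pmull// expn_gt0.
have := hc _ an; rewrite -/N.
(* No mass is lost in an empty cell: the lower bound on the count forces [sg u] to vanish. *)
have [->|N0] := eqVneq N 0.
  rewrite mulr0 pmulr_lle0 ?ltr0n ?muln_gt0 ?expn_gt0// => s0.
  have -> : sg u = 0 by apply/eqP; rewrite eq_le s0 sg0.
  by rewrite !mul0r.
have : q.+1%:R != 0 :> R by rewrite pnatr_eq0.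
by move: (q.+1%:R) => p p0 _; field; rewrite N0 p0.
Qed.

(* The intervals have been shrunk to radius len/4. The bound consists of a
   diagonal term, a near-diagonal term controlled by (A2), and
   a term depending on the two cells only. *)
Lemma pair_energy_le {R : realType} (c : nat -> R) (lambda b r d : R) (M u v k l : nat) :
  0 < lambda -> 0 < r -> (0 < M)%N -> (0 < k)%N ->
  incell b r M u (c k) -> incell b r M v (c l) -> (u < M)%N -> (v < M)%N -> r <= 1 ->
  (k != l -> c k != c l /\ (len lambda k + len lambda l) / (2 * `|c k - c l|) < 2^-1) ->
  (forall i, i = k \/ i = l -> 0 < c i < 1) ->
  4 * (r / M%:R) <= d ->
  (if k == l then 10 - ln (len lambda k / 4)
   else - ln (`|c k - c l| - len lambda k / 4 - len lambda l / 4)) <=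
  (k == l)%:R * ((lambda + 12) * k%:R) + near c d k l + ln 2 +
  (ln 2 - ln r + (ln M%:R - ln (maxn 1 (ndist u v))%:R)).
Proof.
move=> la0 r0 M0 k0 hu hv uM vM r1 hkl c01 hd.
have ln20 : 0 <= ln 2 :> R by rewrite ln_ge0//; lra.
have ln21 : ln 2 <= 1 :> R by have := @ln_le_subr1 R 2; rewrite ltr0n => /(_ isT); lra.
have lnr : ln r <= 0 by rewrite ln_le0.
have K0 : 0 <= ln M%:R - ln (maxn 1 (ndist u v))%:R :> R.
  exact: ln_ndist_ge0.
have [kl|kl] := eqVneq k l.
  rewrite /near kl eqxx/= mul1r addr0.
  (* The constant 10 + 2 ln 2 is at most 12, hence at most 12 k because k >= 1. *)
  rewrite ln_div ?posrE ?len_gt0// (_ : 4 = 2 * 2 :> R); last by ring.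
  rewrite lnM ?posrE// /len expRK.
  have : 1 <= l%:R :> R by rewrite -kl ler1n.
  by nra.
have [ckl hlen] := hkl kl.
have D0 : 0 < `|c k - c l| by rewrite normr_gt0 subr_eq0.
rewrite ltr_pdivrMr ?mulr_gt0// in hlen.
have D1 : `|c k - c l| <= 1.
  have := c01 k (or_introl erefl); have := c01 l (or_intror erefl).
  by move=> /andP[? ?] /andP[? ?]; rewrite ler_norml; apply/andP; split; lra.
rewrite mul0r add0r.
(* The ratio in (A3) being below 1/2, the two lengths add up to less than the distance of the
   centers; removing a quarter of them leaves more than half of that distance. *)
apply: (@le_trans _ _ (- ln (`|c k - c l| / 2))).
  by apply: ler_Nln; lra.
rewrite ln_div ?posrE// opprB -addrA [leRHS]addrCA lerD2l.
rewrite /near kl/=; case: ltP => hdist; first by lra.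
rewrite add0r; exact: (far_cells _ _ _ _ _ _ _ _ r0 M0 hu hv hd hdist).
Qed.

(** * Clusters inside a ball *)

(** C must not depend on M: the number of cells is chosen after the radius that (A2) returns for the
    tolerance 1/C^2. The bound 2/M makes the cell masses a bounded density at scale 1/M. *)
Definition has_cell_weights {R : realType} (c : nat -> R) (b r : R) : Prop :=
  exists2 C : R, 0 < C & forall M : nat, (0 < M)%N -> exists sg : 'I_M -> R,
    [/\ forall u, 0 <= sg u, \sum_u sg u = 1, forall u, sg u <= 2 / M%:R &
        exists N : nat, forall n, (N <= n)%N -> forall u : 'I_M,
          sg u * n%:R <= C * cellcount c b r M u n].

(** The energy splits into four sums: diagonal at most 1, near pairs at most 1, the constant ln 2,
    and the cell kernel at most ln 2 - ln r + 6. Since ln 2 <= 1 they add up to at most 10 - ln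
    r. *)
Lemma exists_subcluster {R : realType} (lambda : R) (c : nat -> R) (q : nat -> nat)
    (b r : R) (m : nat) :
  0 < lambda -> (forall k : nat, (1 <= k)%N -> 0 < c k < 1) ->
  (forall M : nat, exists N : nat, forall n, (N <= n)%N -> (M <= q n)%N) ->
  assumption_A2 c q -> assumption_A3 lambda c q ->
  0 < r -> 0 <= b - r -> b + r <= 1 -> has_cell_weights c b r ->
  exists s : cluster R,
    [/\ inside s (b - r) (b + r),
        forall k, exists2 j, (m <= j)%N & ctr s k = c j /\ rad s k = len lambda j / 4 &
        cenergy s <= 10 - ln r].
Proof.
move=> la0 c01 qoo A2 A3 r0 br0 br1 [C C0 HC].
have r1 : r <= 1 by lra.
have C20 : 0 < C ^- 2 by rewrite invr_gt0 exprn_gt0.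
have [d d0 [N1 HN1]] := A2 _ C20.
(* Four cell widths fit in d, as [far_cells] demands of pairs not covered by (A2). *)
pose M := (Num.truncn (4 * r / d)).+1.
have M0 : (0 < M)%N by [].
have M0' : 0 < M%:R :> R by rewrite ltr0n.
have hd : 4 * (r / M%:R) <= d.
  have := truncnS_gt (4 * r / d); rewrite -/M ltr_pdivrMr// => h.
  by rewrite mulrA ler_pdivrMr// [d * _]mulrC ltW.
have [sg [sg0 sg1 sgM [N2 HN2]]] := HC _ M0.
have half0 : 0 < 2^-1 :> R by [].
have [N3 HN3] := A3 _ half0.
pose La := lambda + 12.
have La0 : 0 < La by rewrite /La; lra.
(* With more than 2 C La levels the diagonal sum falls below 1. *)
have [N4 HN4] := qoo (Num.truncn (2 * C * La)).+1.
have rr0 : 0 < 2 * r by rewrite mulr_gt0.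
have [N5 HN5] := len_cvg0 _ _ la0 rr0.
have [n [n0 nN1 nN2] [nN3 nN4 nN5 nm]] : exists2 n,
    [/\ 0 < n, N1 <= n & N2 <= n]%N & [/\ N3 <= n, N4 <= n, N5 <= n & m <= n]%N.
  by exists (N1 + N2 + N3 + N4 + N5 + m + 1)%N; clear; split; lia.
have {}HN1 := HN1 n nN1; have {}HN3 := HN3 n nN3; have {}HN4 := HN4 n nN4.
move: HN1 HN3 HN4; move: (q n) => Q HN1 HN3 HN4.
pose H := level_index Q n.
have posn (h : H) : (n <= pos h)%N.
  have /andP[h1 _] := pos_bounds h; apply: leq_trans h1.
  by rewrite leq_pmull// expn_gt0.
have levn (h : H) : (n <= lev h)%N by rewrite leq_pmull// expn_gt0.
have lev0 (h : H) : 0 < (lev h)%:R :> R by rewrite ltr0n (leq_trans n0).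
have hcount n' : (n <= n')%N -> forall u, sg u * n'%:R <= C * cellcount c b r M u n'.
  by move=> nn'; apply: HN2; exact: leq_trans nN2 nn'.
pose cw := cell_wt c b r M sg Q n.
have cw0 u h : 0 <= cw u h by exact: cell_wt_ge0.
have cwle u h : cw u h <= C / (Q.+1%:R * (lev h)%:R) * (incell b r M u (c (pos h)))%:R.
  by apply: cell_wt_le => //; apply: hcount.
have cwsum u : \sum_h cw u h = sg u.
  by apply: (cell_wt_sum c b r C M sg Q n u n0 sg0) => n' nn'; apply: hcount.
have cwin u h : 0 < cw u h -> incell b r M u (c (pos h)).
  by rewrite /cw /cell_wt; case: incell => //; rewrite mul0r ltxx.
(* A ball is indexed by a cell and a point; the pair has positive weight only if the point lies in
   the cell, so each point is used at most once. *)
pose I : finType := ('I_M * H)%type.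
have sumI (F : 'I_M -> H -> R) : \sum_(x : I) F x.1 x.2 = \sum_u \sum_h F u h.
  by rewrite pair_bigA.
pose B (x : I) := c (pos x.2); pose L (x : I) := len lambda (pos x.2) / 4.
pose w (x : I) := cw x.1 x.2.
have w0 x : 0 <= w x by exact: cw0.
have w1 : \sum_x w x = 1 by rewrite (sumI cw) -sg1; apply: eq_bigr.
have sep k l : inAq n Q k -> inAq n Q l -> k != l ->
    c k != c l /\ (len lambda k + len lambda l) / (2 * `|c k - c l|) < 2^-1.
  by move=> hk hl /eqP; apply: HN3.
have lenr (h : H) : len lambda (pos h) < 2 * r.
  by apply: HN5; exact: leq_trans nN5 (posn h).
have Bin x : 0 < w x -> b - r < B x - L x /\ B x + L x < b + r.
  move=> /cwin/incell_itv-/(_ r0 (ltn_ord _))/andP[h1 h2].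
  by rewrite /B /L; have := lenr x.2; lra.
have xy_pos x y : 0 < w x -> 0 < w y -> (pos x.2 == pos y.2) = (x == y).
  move=> wx wy; apply/eqP/eqP => [/pos_inj xy|->//].
  have := cwin _ _ wy; rewrite -xy => /(incell_inj _ _ _ _ _ _ r0 (cwin _ _ wx))/ord_inj.
  by case: x y xy {wx wy} => [u h] [v g] /= -> ->.
have [||s [sI sE]] := cluster_of_weights I B L w w0 w1.
- move=> x wx; have [h1 h2] := Bin x wx; have := len_gt0 lambda (pos x.2).
  by split; rewrite /L in h1 h2 *; lra.
- move=> x y wx wy; rewrite -xy_pos// => xy.
  have [h1] := sep _ _ (pos_inAq x.2) (pos_inAq y.2) xy.
  have D0 : 0 < `|B x - B y| by rewrite normr_gt0 subr_eq0.
  by rewrite ltr_pdivrMr ?mulr_gt0//; rewrite /L /B in D0 *; lra.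
exists s; split.
- by move=> k; have [x [wx -> ->]] := sI k; apply: Bin.
- move=> k; have [x [wx -> ->]] := sI k; exists (pos x.2) => //.
  by exact: leq_trans nm (posn x.2).
rewrite sE.
pose K u v : R := ln 2 - ln r + (ln M%:R - ln (maxn 1 (ndist u v))%:R).
have pe x y : w x * w y * pair_energy B L x y <=
    w x * w y * ((x == y)%:R * (La * (pos x.2)%:R)) +
    w x * w y * near c d (pos x.2) (pos y.2) + w x * w y * ln 2 + w x * w y * K x.1 y.1.
  have := w0 x; rewrite le_eqVlt => /predU1P[<-|wx]; first by rewrite !mul0r !addr0.
  have := w0 y; rewrite le_eqVlt => /predU1P[<-|wy]; first by rewrite !mulr0 !mul0r !addr0.
  rewrite -!mulrDr (ler_wpM2l (mulr_ge0 (w0 x) (w0 y)))// /pair_energy -(xy_pos x y wx wy).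
  apply: pair_energy_le => //; rewrite ?ltn_ord//.
  - exact: leq_trans (posn _).
  - exact: cwin.
  - exact: cwin.
  - by apply: sep; apply: pos_inAq.
  - by move=> i [->|->]; apply: c01; apply: leq_trans (posn _).
apply: le_trans (ler_sum _ (fun x _ => ler_sum _ (fun y _ => pe x y))) _.
under eq_bigr do rewrite !big_split.
rewrite !big_split /=.
(* A weight is at most C/((Q+1) lev) and its self-energy at most 2 La lev: the size of the level
   cancels and the gain 1/(Q+1) remains. *)
have T1 : \sum_x \sum_y w x * w y * ((x == y)%:R * (La * (pos x.2)%:R)) <= 1.
  rewrite -[leRHS]w1; apply: ler_sum => x _.
  rewrite (bigD1 x)//= eqxx/= mul1r big1 ?addr0; last first.
    by move=> y; rewrite eq_sym => /negPf ->; rewrite /= mul0r mulr0.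
  rewrite -mulrA (ler_piMr (w0 x))//.
  have Q0 : 0 < Q.+1%:R :> R by rewrite ltr0n.
  apply: (@le_trans _ _ (C / (Q.+1%:R * (lev x.2)%:R) * (La * (2 * (lev x.2)%:R)))).
    apply: ler_pM => //; first by rewrite mulr_ge0// ltW.
      apply: le_trans (cwle _ _) _; rewrite ler_piMr//; last by case: incell.
      by rewrite divr_ge0 ?mulr_ge0 ?ltW.
    rewrite ler_wpM2l ?(ltW La0)// -natrM ler_nat.
    by have /andP[_ /ltnW] := pos_bounds x.2.
  have -> : C / (Q.+1%:R * (lev x.2)%:R) * (La * (2 * (lev x.2)%:R)) = 2 * C * La / Q.+1%:R.
    by move: (Q.+1%:R) Q0 => p p0; field; rewrite !gt_eqF.
  rewrite ler_pdivrMr// mul1r; apply/ltW/(lt_le_trans (truncnS_gt _)).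
  by rewrite ler_nat (leq_trans HN4).
have T2 : \sum_x \sum_y w x * w y * near c d (pos x.2) (pos y.2) <= 1.
  have W h : \sum_u cw u h <= C / (Q.+1%:R * (lev h)%:R).
    apply: le_trans (ler_sum _ (fun u _ => cwle u h)) _.
    by rewrite -mulr_sumr ler_piMr ?sum_incell_le1// divr_ge0 ?mulr_ge0 ?ltW.
  have W0 h : 0 <= \sum_u cw u h by exact: sumr_ge0.
  have sumw (F : H -> R) : \sum_x w x * F x.2 = \sum_h (\sum_u cw u h) * F h.
    rewrite (sumI (fun u h => cw u h * F h)) exchange_big; apply: eq_bigr => h _.
    by rewrite mulr_suml.
  have nr0 (g h : H) : 0 <= near c d (pos g) (pos h).
    rewrite /near; case: ifP => // /andP[gh _]; rewrite oppr_ge0 ln_le0//.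
    have := c01 _ (leq_trans n0 (posn g)); have := c01 _ (leq_trans n0 (posn h)).
    by move=> /andP[? ?] /andP[? ?]; rewrite ler_norml; apply/andP; split; lra.
  (* After summing over cells, the weight of a point is at most [V a], constant on its level. For
     each pair of levels (A2) then gives (Q+1)^-2, and there are (Q+1)^2 pairs. *)
  pose V a : R := C / (Q.+1%:R * (2 ^ a * n)%:R).
  have V0 a : 0 <= V a by rewrite divr_ge0 ?(ltW C0)// mulr_ge0.
  apply: (@le_trans _ _ (\sum_(h : H) \sum_(g : H) V (tag h) * V (tag g) * near c d (pos h) (pos g))).
    rewrite (eq_bigr (fun x => w x * \sum_h (\sum_u cw u h) * near c d (pos x.2) (pos h))); last first.
      move=> x _; rewrite -(sumw (fun h => near c d (pos x.2) (pos h))) mulr_sumr.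
      by apply: eq_bigr => y _; rewrite mulrA.
    rewrite (sumw (fun g => \sum_h (\sum_u cw u h) * near c d (pos g) (pos h))).
    apply: ler_sum => h _; rewrite mulr_sumr; apply: ler_sum => g _; rewrite mulrA.
    by rewrite ler_wpM2r// ler_pM// W.
  rewrite (eq_bigr (fun h : H => \sum_(a < Q.+1) \sum_(2 ^ a * n <= l < 2 * (2 ^ a * n))
      V (tag h) * V a * near c d (pos h) l)); last first.
    by move=> h _; rewrite (sum_levels Q n (fun a l => V (tag h) * V a * near c d (pos h) l)).
  rewrite (sum_levels Q n (fun a k => \sum_(a' < Q.+1) \sum_(2 ^ a' * n <= l < 2 * (2 ^ a' * n))
      V a * V a' * near c d k l)).
  have Q0 : Q.+1%:R != 0 :> R by rewrite pnatr_eq0.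
  apply: (@le_trans _ _ (\sum_(a < Q.+1) \sum_(a' < Q.+1) (Q.+1%:R^-1 * Q.+1%:R^-1))); last first.
    have S : \sum_(a < Q.+1) Q.+1%:R^-1 = 1 :> R.
      by rewrite sumr_const card_ord -[LHS]mulr_natr mulVf.
    by under eq_bigr do rewrite -mulr_sumr S mulr1; rewrite S.
  apply: ler_sum => a _; rewrite exchange_big /=; apply: ler_sum => a' _.
  have an (e : 'I_Q.+1) : (0 < 2 ^ e * n)%N by rewrite muln_gt0 expn_gt0.
  have ds (e : 'I_Q.+1) : dyadic_scale n Q (2 ^ e * n) by exists e; rewrite -ltnS.
  have nn : forall k l, (2 ^ a * n <= k < 2 * (2 ^ a * n))%N ->
      (2 ^ a' * n <= l < 2 * (2 ^ a' * n))%N -> k != l -> c k != c l.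
    move=> k l hk hl kl; have [] // := sep k l _ _ kl.
    - by exists a; rewrite -ltnS.
    - by exists a'; rewrite -ltnS.
  have := near_sum c _ _ d _ (an a) (an a') nn (HN1 _ _ (ds a) (ds a')).
  under eq_bigr do rewrite -mulr_sumr.
  rewrite -mulr_sumr => /(ler_wpM2l (mulr_ge0 (V0 a) (V0 a'))) /le_trans; apply.
  have A (e : 'I_Q.+1) : (2 ^ e * n)%:R != 0 :> R by rewrite pnatr_eq0 -lt0n.
  rewrite le_eqVlt; apply/orP; left; apply/eqP; rewrite /V.
  move: (A a) (A a') Q0; move: (_%:R) (_%:R) (Q.+1%:R) => x y z x0 y0 z0.
  by field; rewrite x0 y0 z0 gt_eqF.
have T3 : \sum_(x : I) \sum_(y : I) w x * w y * ln 2 = ln 2.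
  under eq_bigr do rewrite -mulr_suml -mulr_sumr w1 mulr1.
  by rewrite -mulr_suml w1 mul1r.
(* The cell kernel sees only the marginal [sg]; the 6 is the product of 2/M with the row bound 3M of
   [sum_ln_ndist]. *)
have T4 : \sum_(x : I) \sum_(y : I) w x * w y * K x.1 y.1 <= ln 2 - ln r + 6.
  have sumw (F : 'I_M -> R) : \sum_x w x * F x.1 = \sum_u sg u * F u.
    rewrite (sumI (fun u h => cw u h * F u)); apply: eq_bigr => u _.
    by rewrite -mulr_suml cwsum.
  rewrite (eq_bigr (fun x => w x * \sum_v sg v * K x.1 v)); last first.
    move=> x _; rewrite -(sumw (K x.1)) mulr_sumr.
    by apply: eq_bigr => y _; rewrite mulrA.
  rewrite (sumw (fun u => \sum_v sg v * K u v)).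
  have -> : ln 2 - ln r + 6 = \sum_u sg u * (ln 2 - ln r + 6) by rewrite -mulr_suml sg1 mul1r.
  apply: ler_sum => u _; rewrite ler_wpM2l//.
  rewrite (eq_bigr (fun v => sg v * (ln 2 - ln r) +
      sg v * (ln M%:R - ln (maxn 1 (ndist u v))%:R))); last by move=> v _; rewrite mulrDr.
  rewrite big_split/= -mulr_suml sg1 mul1r lerD2l.
  have f0 (v : 'I_M) : 0 <= ln M%:R - ln (maxn 1 (ndist u v))%:R :> R.
    exact: ln_ndist_ge0.
  apply: (@le_trans _ _ (\sum_(v < M) 2 / M%:R * (ln M%:R - ln (maxn 1 (ndist u v))%:R))).
    by apply: ler_sum => v _; rewrite ler_wpM2r.
  rewrite -mulr_sumr; apply: le_trans (_ : 2 / M%:R * (3 * M%:R) <= _).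
    by rewrite ler_wpM2l ?sum_ln_ndist ?divr_ge0.
  by rewrite mulrCA mulfVK ?gt_eqF//; lra.
have ln21 : ln 2 <= 1 :> R by have := @ln_le_subr1 R 2; rewrite ltr0n => /(_ isT); lra.
by rewrite T3; lra.
Qed.

(** * Cell weights from (A1) *)

(* [integrable] and [almost_everywhere] in [assumption_A1] refer to the Borel
   structure of [R], the integral to the one of [measurableTypeR R]; the two
   have the same measurable sets. *)
Lemma lebesgue_integrable_measurableTypeR {R : realType} (f : R -> R) :
  (lebesgue_measure : set R -> \bar R).-integrable `[0, 1] (EFin \o f) ->
  (@lebesgue_measure R).-integrable `[0, 1] (EFin \o f).
Proof.
move=> /integrableP[mf foo]; apply/integrableP; split; first exact: mf.
apply: le_lt_trans foo; rewrite le_eqVlt; apply/orP; left; apply/eqP.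
pose id' : measurableTypeR R -> R := id.
have mid : measurable_fun [set: measurableTypeR R] id'.
  by move=> _ Y mY; rewrite setTI; exact: mY.
have mn : measurable_fun (`[0%R, 1%R]%classic : set R) (fun x => `|(EFin \o f) x|%E).
  exact: measurableT_comp.
by rewrite -(ge0_integral_pushforward mid (@lebesgue_measure R) _ mn).
Qed.

Lemma le_lebesgue {R : realType} (A B : set R) : measurable A -> measurable B ->
  A `<=` B -> (lebesgue_measure A <= lebesgue_measure B)%E.
Proof. by move=> mA mB AB; apply: le_measure; rewrite ?inE. Qed.

Lemma lebesgue_unit_lty {R : realType} (A : set R) : measurable A ->
  A `<=` `[0%R, 1%R] -> (lebesgue_measure A < +oo)%E.
Proof.
move=> mA A01; apply: (@le_lt_trans _ _ (lebesgue_measure (`[0%R, 1%R]%classic : set R))).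
  by apply: le_measure; rewrite ?inE.
by rewrite lebesgue_measure_itv/= lte_fin ltr01 -EFinB ltry.
Qed.

Definition sublevel {R : realType} (phi : R -> R) (t : R) : set R :=
  `[0%R, 1%R]%classic `&` [set x | phi x <= t].

(** The sets where phi is at most 1/(k+1) decrease to a null set, phi being positive almost
    everywhere; continuity from above applies because [0,1] has finite measure. *)
Lemma density_small_set {R : realType} (phi : R -> R) (e : R) : 0 < e ->
  (@lebesgue_measure R).-integrable `[0, 1] (EFin \o phi) ->
  {ae (@lebesgue_measure R), forall x, `[0, 1]%classic x -> 0 < phi x} ->
  exists2 t : R, 0 < t &
    measurable (sublevel phi t) /\ (lebesgue_measure (sublevel phi t) < e%:E)%E.
Proof.
move=> e0 /integrableP[/measurable_EFinP mphi _] [N [mN N0 subN]].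
pose E k : set R := sublevel phi k.+1%:R^-1.
have mE k : measurable (E k).
  rewrite (_ : E k = `[0%R, 1%R]%classic `&` phi @^-1` `]-oo, k.+1%:R^-1]%classic).
    exact: mphi.
  by rewrite /E; apply/seteqP; split=> x [h1 h2]; split => //=;
    move: h2; rewrite /= in_itv.
have E01 k : (lebesgue_measure (E k) < +oo)%E.
  by apply: lebesgue_unit_lty => // x [].
have mcap : measurable (\bigcap_k E k) by exact: bigcapT_measurable.
have cv : lebesgue_measure (E k) @[k --> \oo] --> lebesgue_measure (\bigcap_k E k).
  apply: nonincreasing_cvg_mu => //; first exact: E01.
  move=> n m nm; apply/subsetPset => x [h1 h2]; split => //=.
  by apply: le_trans h2 _; rewrite lef_pV2 ?posrE ?ltr0n// ler_nat.
have z : lebesgue_measure (\bigcap_k E k) = 0%E.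
  apply: (@subset_measure0 _ (measurableTypeR R) R (@lebesgue_measure R) _ N mcap mN _ N0).
  move=> x Ex; apply: subN => /= h; have [x01 _] := Ex 0%N I.
  have := h x01; rewrite ltNge => /negP; apply.
  rewrite leNgt; apply/negP => p0.
  have [_ /=] := Ex (Num.truncn (phi x)^-1) I; apply/negP; rewrite -ltNge.
  by rewrite -[ltRHS]invrK ltf_pV2 ?posrE ?invr_gt0 ?ltr0n// truncnS_gt.
have e0' : (0%:E < e%:E)%E by rewrite lte_fin.
rewrite z in cv; have [k _ hk] := cv _ (open_ereal_lt' e0').
by exists k.+1%:R^-1; [rewrite invr_gt0 ltr0n|split; [exact: mE|exact: (hk k (leqnn k))]].
Qed.

(** * Continuous test functions and the number of points in a cell *)

Definition trapezoid {R : realType} (m h : R) (x : R) : R :=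
  Num.min 1 (Num.max 0 (2 - `|x - m| / h)).

Lemma continuous_trapezoid {R : realType} (m h : R) : continuous (trapezoid m h).
Proof.
rewrite /trapezoid.
apply: (@min_fun_continuous _ R R (fun=> 1)); first exact: cst_continuous.
apply: (@max_fun_continuous _ R R (fun=> 0)); first exact: cst_continuous.
move=> x; apply: cvgB; first exact: cvg_cst.
apply: cvgMl; apply: cvg_norm; apply: cvgB; [exact: cvg_id|exact: cvg_cst].
Qed.

Lemma trapezoid_ge0 {R : realType} (m h x : R) : 0 <= trapezoid m h x.
Proof. by rewrite /trapezoid le_min ler01 le_max lexx. Qed.

Lemma trapezoid_le1 {R : realType} (m h x : R) : trapezoid m h x <= 1.
Proof. by rewrite /trapezoid ge_min lexx. Qed.

Lemma trapezoid1 {R : realType} (m h x : R) : 0 < h -> `|x - m| <= h -> trapezoid m h x = 1.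
Proof.
move=> h0 xm; have : `|x - m| / h <= 1 by rewrite ler_pdivrMr// mul1r.
by move=> ?; rewrite /trapezoid min_l// le_max; apply/orP; right; lra.
Qed.

Lemma trapezoid0 {R : realType} (m h x : R) : 0 < h -> 2 * h <= `|x - m| -> trapezoid m h x = 0.
Proof.
move=> h0 xm; have ? : 2 <= `|x - m| / h by rewrite ler_pdivlMr.
by rewrite /trapezoid (max_l (_ : 2 - _ <= 0)) ?min_r//; lra.
Qed.

Lemma Rintegral_trapezoid_ge {R : realType} (phi : R -> R) (m h t : R) (G : set R) :
  0 < h -> 0 < t ->
  (@lebesgue_measure R).-integrable `[0, 1] (EFin \o phi) ->
  {ae (@lebesgue_measure R), forall x, `[0, 1]%classic x -> 0 < phi x} ->
  measurable G -> G `<=` `[0%R, 1%R] ->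
  (forall x, G x -> `|x - m| <= h /\ t < phi x) ->
  t * fine (lebesgue_measure G) <=
  Rintegral lebesgue_measure `[0, 1] (fun x => trapezoid m h x * phi x).
Proof.
move=> h0 t0 iphi aep mG G01 hG.
have mf : measurable_fun (`[0%R, 1%R]%classic : set R) (trapezoid m h).
  apply: measurable_funTS; apply: continuous_measurable_fun; exact: continuous_trapezoid.
have iF : (@lebesgue_measure R).-integrable `[0, 1]
    (EFin \o (fun x => trapezoid m h x * phi x)).
  have bf : [bounded trapezoid m h x | x in (`[0%R, 1%R]%classic : set R)].
    exists 1; split => // M M1 x _ /=; rewrite ger0_norm ?trapezoid_ge0//.
    by apply: le_trans (ltW M1); exact: trapezoid_le1.
  have m01 : measurable (`[0%R, 1%R]%classic : set R) by [].
  exact: (@integrableMr _ (measurableTypeR R) R (@lebesgue_measure R) _ m01 _ _ mf bf iphi).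
have mF : measurable_fun (`[0%R, 1%R]%classic : set R) (fun x => trapezoid m h x * phi x).
  by apply: measurable_funM => //; case/integrableP: iphi => /measurable_EFinP.
have Gfin : lebesgue_measure G \is a fin_num.
  by rewrite ge0_fin_numE//; exact: lebesgue_unit_lty.
rewrite -lee_fin EFinM fineK// /Rintegral fineK; last exact: integrable_fin_num.
(* Positivity of phi holds only almost everywhere; truncation at 0 makes the integrand nonnegative
   everywhere without changing the integral. *)
pose g x := Num.max 0 (trapezoid m h x * phi x).
have mg : measurable_fun (`[0%R, 1%R]%classic : set R) g.
  by apply: measurable_maxr.
have -> : (\int[lebesgue_measure]_(x in (`[0%R, 1%R]%classic : set R)) (trapezoid m h x * phi x)%:E =
    \int[lebesgue_measure]_(x in (`[0%R, 1%R]%classic : set R)) (g x)%:E)%E.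
  apply: ae_eq_integral => //; [exact/measurable_EFinP|exact/measurable_EFinP|].
  case: aep => N [mN N0 subN]; exists N; split => //; apply: subset_trans subN.
  apply: subsetC => x + x01 => /(_ x01) px; rewrite /g /= max_r//.
  by rewrite mulr_ge0 ?trapezoid_ge0 ?ltW.
have -> : (t%:E * lebesgue_measure G =
    \int[lebesgue_measure]_(x in (`[0%R, 1%R]%classic : set R)) (t%:E * (\1_G x)%:E))%E.
  rewrite ge0_integralZl//; last by rewrite lee_fin ltW.
  - by rewrite integral_indic// setIidl.
  - by apply/measurable_EFinP; exact: measurable_indic.
apply: ge0_le_integral => //.
- by move=> x _; rewrite mule_ge0 ?lee_fin ?(ltW t0).
- by apply/measurable_EFinP; apply: measurable_funM => //; exact: measurable_indic.
- exact/measurable_EFinP.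
move=> x _; rewrite -EFinM lee_fin /g indicE.
case: (boolP (x \in G)) => [|_]; last by rewrite mulr0 le_max lexx.
rewrite inE mulr1 => /hG[h1 h2]; rewrite trapezoid1// mul1r le_max (ltW h2) orbT//.
Qed.

Lemma cell_core {R : realType} (b r : R) (M u : nat) (x : R) : 0 < r -> (0 < M)%N ->
  `|x - (b - r / 2 + (u%:R + 2^-1) * (r / M%:R))| < r / M%:R / 2 -> incell b r M u x.
Proof.
move=> r0 M0; have e0 : 0 < r / M%:R by rewrite divr_gt0 ?ltr0n.
by rewrite ltr_norml /incell -[u.+1%:R]natr1 => /andP[? ?]; apply/andP; split; lra.
Qed.

Lemma trapezoid_le_incell {R : realType} (b r : R) (M u : nat) (x : R) : 0 < r -> (0 < M)%N ->
  trapezoid (b - r / 2 + (u%:R + 2^-1) * (r / M%:R)) (r / M%:R / 4) x <= (incell b r M u x)%:R.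
Proof.
move=> r0 M0; have e0 : 0 < r / M%:R by rewrite divr_gt0 ?ltr0n.
have [h|h] := ltP `|x - (b - r / 2 + (u%:R + 2^-1) * (r / M%:R))| (r / M%:R / 2).
  by rewrite cell_core// trapezoid_le1.
by rewrite trapezoid0//; lra.
Qed.

(** The trapezoid equal to 1 on the middle half of the cell lies below the indicator of the cell. By
    (A1) its averages tend to at least t|G|, and half of this value is eventually exceeded. *)
Lemma cellcount_eventually {R : realType} (c : nat -> R) (phi : R -> R) (b r t : R) (M u : nat)
    (G : set R) :
  (forall f : R -> R, {within `[0, 1], continuous f} ->
    ((n%:R)^-1 * \sum_(n <= k < 2 * n) f (c k)) @[n --> \oo] -->
      Rintegral lebesgue_measure `[0, 1] (fun x => f x * phi x)) ->
  (@lebesgue_measure R).-integrable `[0, 1] (EFin \o phi) ->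
  {ae (@lebesgue_measure R), forall x, `[0, 1]%classic x -> 0 < phi x} ->
  0 < r -> 0 < t -> (0 < M)%N -> measurable G -> G `<=` `[0%R, 1%R] ->
  (forall x, G x ->
    `|x - (b - r / 2 + (u%:R + 2^-1) * (r / M%:R))| <= r / M%:R / 4 /\ t < phi x) ->
  \forall n \near \oo, t / 2 * fine (lebesgue_measure G) * n%:R <= cellcount c b r M u n.
Proof.
move=> A1 iphi aep r0 t0 M0 mG G01 hG.
have e0 : 0 < r / M%:R by rewrite divr_gt0 ?ltr0n.
have h0 : 0 < r / M%:R / 4 by lra.
have [z|z] := eqVneq (fine (lebesgue_measure G)) 0.
  by apply: nearW => n; rewrite z mulr0 mul0r cellcount_ge0.
have z0 : 0 < fine (lebesgue_measure G) by rewrite lt_neqAle eq_sym z fine_ge0.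
have := Rintegral_trapezoid_ge _ _ _ _ _ h0 t0 iphi aep mG G01 hG.
have := A1 _ (continuous_subspaceT (continuous_trapezoid (b - r / 2 + (u%:R + 2^-1) * (r / M%:R))
  (r / M%:R / 4))).
set L := Rintegral _ _ _ => cv tL.
have tL2 : t / 2 * fine (lebesgue_measure G) < L by have := mulr_gt0 t0 z0; lra.
have [N _ HN] := cvgr_gt L cv _ tL2; exists N => // n /= Nn; have {HN} := HN n Nn.
have [->|n0] := posnP n; first by rewrite mulr0 cellcount_ge0.
have n0' : 0 < n%:R :> R by rewrite ltr0n.
rewrite /= [_^-1 * _]mulrC ltr_pdivlMr// => /ltW /le_trans; apply.
by apply: ler_sum => k _; exact: trapezoid_le_incell.
Qed.

(** The weight of a cell is proportional to the measure of the part of its middle half where phi >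
    t. The middle halves have total measure r/2 and the set phi <= t measures less than r/4, so the
    normalizing sum S is at least r/4, which yields the bound 2/M. *)
Lemma A1_has_cell_weights {R : realType} (c : nat -> R) (b r : R) :
  assumption_A1 c -> 0 < r -> 0 <= b - r -> b + r <= 1 -> has_cell_weights c b r.
Proof.
move=> [phi [iphi aep A1]] r0 br0 br1.
have {}iphi := lebesgue_integrable_measurableTypeR phi iphi.
have r40 : 0 < r / 4 by lra.
have [t t0 [mE Et]] := density_small_set phi _ r40 iphi aep.
set E := sublevel phi t in mE Et.
(* The factor 2/t comes from [cellcount_eventually], the factor 4/r from S >= r/4. *)
exists (8 / (t * r)); first by rewrite divr_gt0 ?mulr_gt0.
move=> M M0; have M0' : 0 < M%:R :> R by rewrite ltr0n.
pose eta := r / M%:R; have eta0 : 0 < eta by rewrite divr_gt0.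
have etaM : eta * M%:R = r by rewrite mulfVK ?gt_eqF.
pose m u := b - r / 2 + (u%:R + 2^-1) * eta.
pose mid u : set R := `[m u - eta / 4, m u + eta / 4]%classic.
have midP u x : mid u x -> `|x - m u| <= eta / 4.
  by rewrite /mid /= in_itv/= ler_norml => /andP[? ?]; apply/andP; split; lra.
have mid_cell u x : mid u x -> incell b r M u x.
  by move=> /midP h; apply: cell_core => //; rewrite -/eta -/(m u); lra.
have mid01 u x : (u < M)%N -> mid u x -> `[0%R, 1%R]%classic x.
  by move=> uM /mid_cell/(incell_itv _ _ _ _ _ r0 uM)/andP[? ?]; rewrite /= in_itv/=; apply/andP; split; lra.
have mmid u : measurable (mid u) by exact: measurable_itv.
have lmid u : lebesgue_measure (mid u) = (eta / 2)%:E.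
  rewrite /mid lebesgue_measure_itv/= lte_fin ifT; last by lra.
  by rewrite -EFinB; congr (_%:E); lra.
pose G u : set R := mid u `\` E.
have mG u : measurable (G u) by exact: measurableD.
have lG u : (lebesgue_measure (G u) <= (eta / 2)%:E)%E.
  by rewrite -(lmid u); apply: le_lebesgue => // x [].
have fG u : lebesgue_measure (G u) \is a fin_num.
  by rewrite ge0_fin_numE//; apply: le_lt_trans (lG u) (ltry _).
pose mu u := fine (lebesgue_measure (G u)).
have mu0 u : 0 <= mu u by exact: fine_ge0.
have muE u : lebesgue_measure (G u) = (mu u)%:E by rewrite fineK.
have mu_le u : mu u <= eta / 2 by rewrite -lee_fin -muE.
have tmid : trivIset setT mid.
  by move=> i j _ _ [x [/mid_cell hi /mid_cell hj]]; exact: (incell_inj _ _ _ _ _ _ r0 hi hj).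
have tG : trivIset setT G.
  by move=> i j _ _ [x [[hi _] [hj _]]]; apply: (tmid i j I I); exists x.
pose S := \sum_(u < M) mu u.
have S_ge : r / 4 <= S.
  have h1 : lebesgue_measure (\big[setU/set0]_(u < M) mid u) = (r / 2)%:E.
    rewrite measure_bigsetU//; rewrite (eq_bigr (fun=> (eta / 2)%:E)); last by move=> u _; exact: lmid.
    by rewrite sumEFin sumr_const card_ord -[_ *+ M]mulr_natr -etaM mulrAC.
  have h2 : lebesgue_measure (\big[setU/set0]_(u < M) G u) = S%:E.
    by rewrite measure_bigsetU// -sumEFin; apply: eq_bigr => u _; exact: muE.
  have mU : measurable (\big[setU/set0]_(u < M) G u) by exact: bigsetU_measurable.
  have : (lebesgue_measure (\big[setU/set0]_(u < M) mid u) <=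
      lebesgue_measure ((\big[setU/set0]_(u < M) G u) `|` E))%E.
    apply: le_lebesgue; [exact: bigsetU_measurable|exact: measurableU|].
    rewrite -!bigcup_mkord => x [u uM hx].
    by have [?|?] := pselect (E x); [right|left; exists u].
  have hU : (lebesgue_measure ((\big[setU/set0]_(u < M) G u) `|` E) <=
      S%:E + lebesgue_measure E)%E by rewrite -h2; exact: measureU2.
  move=> /le_trans/(_ hU); rewrite h1 => h.
  have := le_trans h (leeD (lexx _) (ltW Et)).
  by rewrite -EFinD lee_fin; lra.
have S0 : 0 < S by lra.
exists (fun u => mu u / S); split.
- by move=> u; rewrite divr_ge0// ltW.
- by rewrite -mulr_suml divff// gt_eqF.
- move=> u; rewrite ler_pdivrMr//; apply: le_trans (mu_le u) _.
  apply: (@le_trans _ _ (2 / M%:R * (r / 4))); last by rewrite ler_wpM2l// divr_ge0.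
  by rewrite le_eqVlt; apply/orP; left; apply/eqP; rewrite /eta; field; rewrite gt_eqF.
have : \forall n \near \oo, forall u : 'I_M, t / 2 * mu u * n%:R <= cellcount c b r M u n.
  apply: filter_forall => u; apply: (cellcount_eventually c phi) => //.
  - by move=> x [/mid01 h _]; apply: h.
  - move=> x [hx nE]; split; first exact: midP.
    rewrite ltNge; apply/negP => h; apply: nE; split => //.
    by apply: mid01 hx.
move=> [N _ HN]; exists N => n Nn u.
have := HN n Nn u.
rewrite -(ler_pM2l (_ : 0 < 8 / (t * r))); last by rewrite divr_gt0 ?mulr_gt0.
apply: le_trans.
have -> : 8 / (t * r) * (t / 2 * mu u * n%:R) = mu u * (4 / r) * n%:R.
  by field; rewrite !gt_eqF.
rewrite ler_wpM2r// ler_wpM2l//.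
by rewrite -[4 / r]invrK lef_pV2 ?posrE ?invr_gt0 ?divr_gt0// invf_div.
Qed.

(** * The limit measure *)

Lemma exists_probability_cdf {R : realType} (F : R -> R) :
  {homo F : x y / x <= y} ->
  (forall x (e : R), 0 < e -> \forall y \near x^'+, F y < F x + e) ->
  (forall x, x < 0 -> F x = 0) -> (forall x, 1 <= x -> F x = 1) ->
  exists nu : probability R R, forall a b, a <= b -> nu `]a, b]%classic = (F b - F a)%:E.
Proof.
move=> ndF rcF F0 F1.
have rc : right_continuous F.
  move=> x; apply/cvgrPdist_lt => e e0; have [d d0 hd] := rcF x e e0.
  near=> y; have xy : x < y by near: y; exact: nbhs_right_gt.
  rewrite distrC ger0_norm ?subr_ge0 ?ndF ?(ltW xy)// ltrBlDl.
  by near: y; exact: rcF.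
have Fy : F @ +oo --> (1 : R).
  by apply: cvg_near_cst; near=> x; apply: F1; near: x; exact: nbhs_pinfty_ge.
have FNy : F @ -oo --> (0 : R).
  by apply: cvg_near_cst; near=> x; apply: F0; near: x; exact: nbhs_ninfty_lt.
pose f : cumulativeBounded (0 : R) (1 : R) := HB.pack F
  (isCumulative.Build R _ R F ndF rc) (isCumulativeBounded.Build R 0 1 F FNy Fy).
(* The Lebesgue-Stieltjes measure lives on [measurableTypeR R]; its image under the identity is a
   probability for the Borel structure of [R]. *)
pose id' : measurableTypeR R -> R := id.
have mid : measurable_fun [set: measurableTypeR R] id'.
  by move=> _ Y mY; rewrite setTI; exact: mY.
pose X : {mfun measurableTypeR R >-> R} := HB.pack id' (isMeasurableFun.Build _ _ _ _ id' mid).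
exists (distribution (lebesgue_stieltjes_measure f) X) => a b ab.
rewrite /distribution /pushforward /= /lebesgue_stieltjes_measure /measure_extension.
rewrite measurable_mu_extE/=; last exact: is_ocitv.
by rewrite wlength_itv_bnd.
Unshelve. all: by end_near. Qed.

(** * Distribution functions of clusters *)

Definition lft {R : realType} (s : cluster R) (i : idx s) : R := ctr s i - rad s i.
Definition rgt {R : realType} (s : cluster R) (i : idx s) : R := ctr s i + rad s i.

Lemma lft_lt_rgt {R : realType} (s : cluster R) (i : idx s) : lft s i < rgt s i.
Proof. by have := rad_gt0 R s i; rewrite /lft /rgt; lra. Qed.

Lemma lft_rgt_disjoint {R : realType} (s : cluster R) (i j : idx s) : i != j ->
  rgt s i < lft s j \/ rgt s j < lft s i.
Proof.
move=> /(separated R s); rewrite /lft /rgt.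
by case: (ger0P (ctr s i - ctr s j)) => ? ?; [right|left]; lra.
Qed.

(** Distribution function of the measure that puts the mass of each ball at its left endpoint;
    refinement then moves mass to the right only, so these functions decrease. *)
Definition stage_cdf {R : realType} (s : cluster R) (x : R) : R :=
  \sum_i wt s i * (lft s i <= x)%R%:R.

Lemma stage_cdf_homo {R : realType} (s : cluster R) : {homo stage_cdf s : x y / x <= y}.
Proof.
move=> x y xy; apply: ler_sum => i _; rewrite ler_wpM2l ?(ltW (wt_gt0 R s i))//.
rewrite ler_nat; case: (boolP (lft s i <= x)) => // h; by rewrite (le_trans h xy).
Qed.

Lemma stage_cdf_ge0 {R : realType} (s : cluster R) x : 0 <= stage_cdf s x.
Proof. by apply: sumr_ge0 => i _; rewrite mulr_ge0// ltW// wt_gt0. Qed.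

Lemma stage_cdf0 {R : realType} (s : cluster R) x : x < 0 -> stage_cdf s x = 0.
Proof.
move=> x0; rewrite /stage_cdf big1// => i _; rewrite leNgt (lt_le_trans x0) ?mulr0//.
exact: left_ge0.
Qed.

Lemma stage_cdf1 {R : realType} (s : cluster R) x : 1 <= x -> stage_cdf s x = 1.
Proof.
move=> x1; rewrite -(wt_sum R s); apply: eq_bigr => i _.
rewrite (_ : lft s i <= x) ?mulr1//; apply: le_trans x1.
by apply: le_trans (right_le1 R s i); exact/ltW/lft_lt_rgt.
Qed.

Lemma stage_cdf_right {R : realType} (s : cluster R) (x : R) :
  \forall y \near x^'+, stage_cdf s y = stage_cdf s x.
Proof.
have : \forall y \near x^'+, forall i : idx s, (lft s i <= y) = (lft s i <= x).
  apply: filter_forall => i; have [h|h] := leP (lft s i) x.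
    near=> y; apply: le_trans h _; apply: ltW; near: y; exact: nbhs_right_gt.
  near=> y; apply/negbTE; rewrite -ltNge; near: y; exact: nbhs_right_lt.
by apply: filterS => y h; apply: eq_bigr => i _; rewrite h.
Unshelve. all: by end_near. Qed.

(** At such a y no ball has mass on both sides, so refinement leaves the distribution function
    unchanged there. *)
Definition gap {R : realType} (s : cluster R) (y : R) : Prop :=
  forall i, lft s i <= y -> rgt s i <= y.

Lemma rgt_gap {R : realType} (s : cluster R) i : gap s (rgt s i).
Proof.
move=> j; have [->//|/lft_rgt_disjoint[h|h] h'] := eqVneq i j; first by lra.
by have := lft_lt_rgt s i; lra.
Qed.

Lemma sum_refines {R : realType} {s t : cluster R} (p : idx t -> idx s) (f : idx s -> R) :
  refines p -> \sum_j wt t j * f (p j) = \sum_i wt s i * f i.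
Proof.
move=> rp; rewrite (partition_big p xpredT)//=; apply: eq_bigr => i _.
rewrite -(ref_wt rp) mulr_suml; apply: eq_bigr => j /eqP ->//.
Qed.

Lemma refines_cdf_le {R : realType} {s t : cluster R} (p : idx t -> idx s) x :
  refines p -> stage_cdf t x <= stage_cdf s x.
Proof.
move=> rp; rewrite /stage_cdf -(sum_refines p _ rp); apply: ler_sum => j _.
rewrite ler_wpM2l ?(ltW (wt_gt0 R t j))// ler_nat.
case: (boolP (lft t j <= x)) => // h; rewrite (le_trans _ h)//.
by have := ref_left rp j; rewrite /lft => /ltW.
Qed.

Lemma refines_cdf_gap {R : realType} {s t : cluster R} (p : idx t -> idx s) y :
  refines p -> gap s y -> stage_cdf t y = stage_cdf s y /\ gap t y.
Proof.
move=> rp gy; split.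
  rewrite /stage_cdf -(sum_refines p _ rp); apply: eq_bigr => j _; congr (_ * (nat_of_bool _)%:R).
  apply/idP/idP => h; first by apply: le_trans h; exact/ltW/(ref_left rp).
  apply: le_trans (gy _ h); apply/ltW/(lt_trans (lft_lt_rgt t j)).
  exact: (ref_right rp).
move=> j h; apply: le_trans (gy (p j) _); first exact/ltW/(ref_right rp).
by apply: le_trans h; exact/ltW/(ref_left rp).
Qed.

(** The left endpoint of a ball is not a gap of [s], where the mass sits on it, but becomes one
    after one refinement, all children starting strictly to its right; hence the strict inequality
    in the sum. *)
Lemma refines_cdf_lft {R : realType} {s t : cluster R} (p : idx t -> idx s) i :
  refines p ->
  stage_cdf t (lft s i) = \sum_a wt s a * (lft s a < lft s i)%R%:R /\ gap t (lft s i).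
Proof.
move=> rp.
have before j : lft s (p j) < lft s i -> rgt t j <= lft s i.
  move=> h; apply/ltW/(lt_trans (ref_right rp j)).
  have pi : p j != i by apply: contraTneq h => ->; rewrite ltxx.
  by case: (lft_rgt_disjoint _ _ _ pi) => // h'; have := lft_lt_rgt s i; lra.
split.
  rewrite -(sum_refines p _ rp); apply: eq_bigr => j _; congr (_ * (nat_of_bool _)%:R).
  apply/idP/idP => h; first by apply: lt_le_trans h; exact: (ref_left rp).
  by apply: le_trans (before j h); exact/ltW/lft_lt_rgt.
by move=> j h; apply: before; apply: lt_le_trans h; exact: (ref_left rp).
Qed.

Lemma stage_cdf_mass {R : realType} (s : cluster R) i :
  stage_cdf s (rgt s i) - \sum_a wt s a * (lft s a < lft s i)%R%:R = wt s i.
Proof.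
rewrite /stage_cdf -sumrB (bigD1 i)//= ltxx mulr0 subr0 (ltW (lft_lt_rgt s i)) mulr1.
rewrite big1 ?addr0// => a ai; rewrite -mulrBr.
have h1 := lft_lt_rgt s i; have h2 := lft_lt_rgt s a.
have [h|h] := lft_rgt_disjoint _ _ _ ai.
  have e1 : lft s a <= rgt s i by lra.
  have e2 : lft s a < lft s i by lra.
  by rewrite e1 e2 subrr mulr0.
have e2 : (lft s a < lft s i) = false by apply/negbTE; rewrite -leNgt; lra.
by rewrite leNgt h e2 subrr mulr0.
Qed.

(** The limit distribution function is the infimum of a decreasing sequence; right-continuity passes
    to it because each stage is locally constant on the right. It agrees with stage k at right
    endpoints and with stage k+1 at left endpoints, and the difference is the weight. *)
Lemma exists_limit_probability {R : realType} (s : nat -> cluster R)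
    (p : forall k, idx (s k.+1) -> idx (s k)) : (forall k, refines (p k)) ->
  exists nu : probability R R, forall k i,
    nu `]lft (s k) i, rgt (s k) i]%classic = (wt (s k) i)%:E.
Proof.
move=> rp.
pose A x : set R := [set stage_cdf (s k) x | k in setT].
have hA x : has_inf (A x).
  split; first by exists (stage_cdf (s 0%N) x); exists 0%N.
  by exists 0 => _ [k _ <-]; exact: stage_cdf_ge0.
pose F x := inf (A x).
have FA k x : F x <= stage_cdf (s k) x.
  by apply: ge_inf; [case: (hA x)|exists k].
have AF x r : (forall k, r <= stage_cdf (s k) x) -> r <= F x.
  by move=> h; apply: lb_le_inf; [case: (hA x)|move=> _ [k _ <-]].
have ndF : {homo F : x y / x <= y}.
  by move=> x y xy; apply: AF => k; apply: le_trans (FA k x) _; exact: stage_cdf_homo.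
have noninc k l x : (k <= l)%N -> stage_cdf (s l) x <= stage_cdf (s k) x.
  elim: l => [|l IH]; first by rewrite leqn0 => /eqP ->.
  rewrite leq_eqVlt => /predU1P[->//|/IH]; apply: le_trans; exact: refines_cdf_le (rp l).
have Fgap k y : gap (s k) y -> F y = stage_cdf (s k) y.
  move=> gy; apply/eqP; rewrite eq_le FA AF// => l.
  have [lk|kl] := leqP l k; first exact: noninc.
  suff [-> _] : stage_cdf (s l) y = stage_cdf (s k) y /\ gap (s l) y by [].
  elim: l {kl} (ltnW kl) => [|l IH]; first by rewrite leqn0 => /eqP <-.
  rewrite leq_eqVlt => /predU1P[<-//|/IH[<- gl]]; exact: refines_cdf_gap (rp l) gl.
have [|||nu hnu] := exists_probability_cdf F ndF.
- move=> x e e0; have Fe : F x < F x + e by rewrite ltrDl.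
  have [_ [k _ <-] hk] : exists2 y, A x y & y < F x + e by apply: (inf_lt _ Fe); case: (hA x).
  have := stage_cdf_right (s k) x; apply: filterS => y hy.
  by apply: le_lt_trans (FA k y) _; rewrite hy.
- move=> x x0; apply/eqP; rewrite eq_le -{1}(stage_cdf0 (s 0%N) x x0) FA AF// => k.
  exact: stage_cdf_ge0.
- move=> x x1; apply/eqP; rewrite eq_le -{1}(stage_cdf1 (s 0%N) x x1) FA AF// => k.
  by rewrite stage_cdf1.
exists nu => k i; rewrite hnu ?(ltW (lft_lt_rgt _ _))//.
have [e g] := refines_cdf_lft (p k) i (rp k).
by rewrite (Fgap _ _ g) e (Fgap k) ?stage_cdf_mass//; exact: rgt_gap.
Qed.

(** * Lower limits and measurability of the logarithmic kernel *)

Lemma le_limn_einf {R : realType} (u : (\bar R)^nat) (a : \bar R) (N : nat) :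
  (forall n, (N <= n)%N -> (a <= u n)%E) -> (a <= limn_einf u)%E.
Proof.
move=> h; rewrite limn_einf_lim (cvg_lim _ (@cvg_einfs_sup _ u))//.
apply: (@le_trans _ _ (einfs u N)); last by apply: ereal_sup_ubound; exists N.
by apply: le_ereal_inf_tmp => _ [n /= Nn <-]; exact: h.
Qed.

Lemma limn_einf_le {R : realType} (u : (\bar R)^nat) (a : \bar R) :
  (forall n, (u n <= a)%E) -> (limn_einf u <= a)%E.
Proof.
move=> h; rewrite limn_einf_lim (cvg_lim _ (@cvg_einfs_sup _ u))//.
apply: ub_ereal_sup => _ [n _ <-]; apply: le_trans (h n).
by apply: ereal_inf_lbound; exists n => /=.
Qed.

Lemma measurable_limn_einf {d} {T : measurableType d} {R : realType} (f : (T -> \bar R)^nat) :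
  (forall n, measurable_fun setT (f n)) -> measurable_fun setT (fun x => limn_einf (f ^~ x)).
Proof.
move=> mf; rewrite (_ : (fun x => _) = (fun x => - limn_esup ((fun n x => - f n x)%E ^~ x))%E).
  apply: measurableT_comp => //; apply: measurable_fun_limn_esup => n.
  exact: measurableT_comp.
by apply/funext.
Qed.

Lemma measurable_logk {R : realType} :
  measurable_fun [set: R * R] (fun x => logk x.1 x.2).
Proof.
rewrite /logk; apply: measurable_fun_if => //.
- exact: measurable_fun_eqr.
- apply: measurable_funTS; apply/measurable_EFinP.
  apply: measurableT_comp => //; apply: measurableT_comp; first exact: measurable_ln.
  apply: measurableT_comp => //; exact: measurable_funB.
Qed.

(** * Energy of the limit measure *)

(** Step kernel whose double integral against the limit measure is [cenergy s]. *)
Definition cell_energy {R : realType} (s : cluster R) (z w : R) : R :=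
  \sum_i \sum_j pair_energy (ctr s) (rad s) i j *
    (\1_(`]lft s i, rgt s i]) z * \1_(`]lft s j, rgt s j]) w).

Lemma cell_energy_ge {R : realType} (s : cluster R) (i j : idx s) (z w : R) :
  `]lft s i, rgt s i]%classic z -> `]lft s j, rgt s j]%classic w ->
  pair_energy (ctr s) (rad s) i j <= cell_energy s z w.
Proof.
move=> zi wj; rewrite /cell_energy (bigD1 i)//= (bigD1 j)//= !indicE !mem_set// !mulr1.
rewrite -addrA lerDl addr_ge0//.
  by apply: sumr_ge0 => k _; rewrite mulr_ge0 ?pair_energy_ge0.
by apply: sumr_ge0 => k _; apply: sumr_ge0 => l _; rewrite mulr_ge0 ?pair_energy_ge0.
Qed.

(* The kernel log(1/|z - w|) is dominated by the step function of stage [s], except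
   when z and w share a ball; there the step function is large. *)
Lemma logk_le_cell_energy {R : realType} (s : cluster R) (i j : idx s) (z w : R) :
  `]lft s i, rgt s i]%classic z -> `]lft s j, rgt s j]%classic w ->
  (forall k, 2 * rad s k < `|z - w|) -> (logk z w <= (cell_energy s z w)%:E)%E.
Proof.
move=> zi wj h.
have d0 : 0 < `|z - w| by apply: lt_trans (h i); rewrite mulr_gt0 ?rad_gt0.
rewrite /logk ifF; last by apply/negbTE; rewrite -subr_eq0 -normr_gt0.
rewrite lee_fin; apply: le_trans (cell_energy_ge _ _ _ _ _ zi wj).
move: zi wj; rewrite /= !in_itv/= /lft /rgt => /andP[z1 z2] /andP[w1 w2].
have [ij|ij] := eqVneq i j.
  have := h i; subst j => hi; exfalso.
  by case: (ger0P (z - w)) hi => ? ?; lra.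
rewrite /pair_energy (negPf ij); apply: ler_Nln.
  by have := separated R s _ _ ij; lra.
by case: (ger0P (ctr s i - ctr s j)); case: (ger0P (z - w)) => ? ?; lra.
Qed.

Lemma integral_step {R : realType} {I : finType} (nu : probability R R) (u : I -> R)
    (B : I -> set R) (a : I -> R) :
  (forall i, measurable (B i)) -> (forall i, nu (B i) = (u i)%:E) -> (forall i, 0 <= a i) ->
  (\int[nu]_z (\sum_i a i * \1_(B i) z)%:E = (\sum_i a i * u i)%:E)%E.
Proof.
move=> mB nuB a0.
have u0 i : 0 <= u i by rewrite -lee_fin -nuB.
have mI i : measurable_fun setT (fun z : R => \1_(B i) z : R) by exact: measurable_indic.
have intI i : (\int[nu]_z (\1_(B i) z)%:E = (u i)%:E)%E.
  by rewrite integral_indic// setIT; exact: nuB.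
under eq_integral do rewrite -sumEFin.
rewrite ge0_integral_sum//; first last.
- by move=> i z _; rewrite lee_fin mulr_ge0.
- by move=> i; apply/measurable_EFinP; exact: measurable_funM.
rewrite -sumEFin; apply: eq_bigr => i _.
under eq_integral do rewrite EFinM.
by rewrite ge0_integralZl//; [rewrite intI|exact/measurable_EFinP|rewrite lee_fin].
Qed.

Lemma measure_disjoint_bigcup {R : realType} {I : finType} (nu : probability R R) (u : I -> R)
    (B : I -> set R) :
  (forall i, measurable (B i)) -> (forall i, nu (B i) = (u i)%:E) ->
  (forall i j z, B i z -> B j z -> i = j) ->
  nu (\bigcup_(i in [set: I]) B i) = (\sum_i u i)%:E.
Proof.
move=> mB nuB disj; pose T := \bigcup_(i in [set: I]) B i.
have mT : measurable T by apply: fin_bigcup_measurable => //; exact: finite_finset.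
have := integral_step nu u _ (fun=> 1) mB nuB (fun=> ler01).
under [X in _ = X%:E]eq_bigr do rewrite mul1r.
move=> <-; rewrite -/T -[T]setIT -integral_indic//.
apply: eq_integral => z _; congr (_%:E); rewrite indicE.
have [/set_mem[i _ zi]|/negP nz] := boolP (z \in T).
  rewrite (bigD1 i)//= indicE mem_set// mul1r big1 ?addr0// => j ji.
  rewrite mul1r indicE memNset// => zj; move/eqP: ji; apply.
  exact: disj zj zi.
rewrite big1// => i _; rewrite mul1r indicE memNset// => zi.
by apply: nz; apply/mem_set; exists i.
Qed.

(** Inner and outer integrals are stated apart because later estimates treat them one after the
    other. *)
Lemma integral_step_kernel {R : realType} {I : finType} (nu : probability R R) (u : I -> R)
    (B : I -> set R) (g : I -> I -> R) :
  (forall i, measurable (B i)) -> (forall i, nu (B i) = (u i)%:E) -> (forall i j, 0 <= g i j) ->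
  (forall w, \int[nu]_z (\sum_i \sum_j g i j * (\1_(B i) z * \1_(B j) w))%:E =
     (\sum_j (\sum_i g i j * u i) * \1_(B j) w)%:E)%E /\
  (\int[nu]_w (\sum_j (\sum_i g i j * u i) * \1_(B j) w)%:E =
     (\sum_i \sum_j u i * u j * g i j)%:E)%E.
Proof.
move=> mB nuB g0; have u0 i : 0 <= u i by rewrite -lee_fin -nuB.
split=> [w|].
  have -> : (fun z => (\sum_i \sum_j g i j * (\1_(B i) z * \1_(B j) w))%:E) =
      (fun z => (\sum_i (\sum_j g i j * \1_(B j) w) * \1_(B i) z)%:E).
    apply/funext => z; congr (_%:E); apply: eq_bigr => i _.
    by rewrite mulr_suml; apply: eq_bigr => j _; ring.
  rewrite (integral_step nu u)//; last by move=> i; apply: sumr_ge0 => j _; rewrite mulr_ge0.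
  congr (_%:E); under eq_bigr do rewrite mulr_suml.
  rewrite exchange_big; apply: eq_bigr => j _.
  by rewrite mulr_suml; apply: eq_bigr => i _; ring.
rewrite (integral_step nu u)//; last by move=> j; apply: sumr_ge0 => i _; rewrite mulr_ge0.
congr (_%:E); under eq_bigr do rewrite mulr_suml.
rewrite exchange_big; apply: eq_bigr => i _.
by apply: eq_bigr => j _; ring.
Qed.

Lemma cell_energy_ge0 {R : realType} (s : cluster R) (z w : R) : 0 <= cell_energy s z w.
Proof.
by apply: sumr_ge0 => i _; apply: sumr_ge0 => j _; rewrite mulr_ge0 ?pair_energy_ge0.
Qed.

Lemma measurable_cell_energy {R : realType} (s : cluster R) (w : R) :
  measurable_fun setT (fun z => (cell_energy s z w)%:E).
Proof.
apply/measurable_EFinP; apply: measurable_sum => i; apply: measurable_sum => j.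
by apply: measurable_funM => //; apply: measurable_funM.
Qed.

Definition logkp {R : realType} (z w : R) : \bar R := maxe (logk z w) 0.

Lemma logkp_ge0 {R : realType} (z w : R) : (0 <= logkp z w)%E.
Proof. by rewrite /logkp le_max lexx orbT. Qed.

Lemma logkE {R : realType} (z w : R) : `|z - w| <= 1 -> logkp z w = logk z w.
Proof.
move=> zw; rewrite /logkp max_l// /logk; case: ifPn => // _.
by rewrite lee_fin oppr_ge0 ln_le0.
Qed.

Lemma measurable_integral_kernel {R : realType} (mu : probability R R) (f : R * R -> \bar R) :
  measurable_fun setT f -> (forall x, (0 <= f x)%E) ->
  measurable_fun setT (fun w => \int[mu]_z f (z, w))%E.
Proof. by move=> mf f0; exact: (@measurable_fun_fubini_tonelli_G _ _ R R R mu f mf f0). Qed.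

Lemma measurable_logkp {R : realType} :
  measurable_fun [set: R * R] (fun x => logkp x.1 x.2).
Proof. by apply: measurable_maxe => //; exact: measurable_logk. Qed.

Lemma measurable_logkp_l {R : realType} (w : R) : measurable_fun setT (fun z : R => logkp z w).
Proof.
exact: (measurableT_comp (@measurable_logkp R) (@pair2_measurable _ _ R R w)).
Qed.

(* log(1/|z - w|) is nonnegative on the unit square, so the negative part is
   invisible to a measure carried by [0,1]. *)
Lemma energy_logkp {R : realType} (mu : probability R R) (K : set R) :
  measurable K -> K `<=` `[0%R, 1%R] -> mu (~` K) = 0%E ->
  energy mu = (\int[mu]_w \int[mu]_z logkp z w)%E.
Proof.
move=> mK K01 nK.
have zw1 z w : K z -> K w -> `|z - w| <= 1.
  move=> /K01 + /K01; rewrite /= !in_itv/= => /andP[? ?] /andP[? ?].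
  by rewrite ler_norml; apply/andP; split; lra.
have mn : measurable_fun [set: R * R] (fun x => maxe (- logk x.1 x.2) 0)%E.
  by apply: measurable_maxe => //; apply: measurableT_comp => //; exact: measurable_logk.
pose N w := (\int[mu]_z maxe (- logk z w) 0)%E.
have mN : measurable_fun setT N.
  by apply: (measurable_integral_kernel mu _ mn) => x; rewrite le_max lexx orbT.
pose P w := (\int[mu]_z logkp z w)%E.
have mP : measurable_fun setT P.
  by apply: (measurable_integral_kernel mu _ measurable_logkp) => x; exact: logkp_ge0.
have E w : (\int[mu]_z logk z w = P w - N w)%E.
  rewrite integralE; congr (_ - _)%E; apply: eq_integral => z _.
    by rewrite funeposE.
  by rewrite funenegE.
rewrite /energy /interaction; under eq_integral do rewrite E.
apply: ae_eq_integral => //; first exact: emeasurable_funB.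
exists (~` K); split => //; first exact: measurableC.
apply: subsetC => w Kw _; rewrite /N (ae_eq_integral (cst 0%E)) ?integral0 ?sube0//.
- exact: (measurableT_comp mn (@pair2_measurable _ _ R R w)).
exists (~` K); split => //; first exact: measurableC.
apply: subsetC => z Kz _ /=; rewrite max_r// oppe_le0.
by rewrite -(logkE _ _ (zw1 _ _ Kz Kw)) logkp_ge0.
Qed.

(** The set K of points lying in a ball at every stage has full measure, and on K x K the
    logarithmic kernel is at most the lower limit of the step kernels. Fatou's lemma, once for each
    integral, bounds the energy by the lower limit of the [cenergy (s k)]. *)
Lemma energy_limit_le {R : realType} (s : nat -> cluster R) (nu : probability R R) (E : R) :
  (forall k i, nu `]lft (s k) i, rgt (s k) i]%classic = (wt (s k) i)%:E) ->
  (forall e : R, 0 < e -> exists N, forall k, (N <= k)%N -> forall i, rad (s k) i < e) ->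
  (forall k, cenergy (s k) <= E) ->
  let T k := \bigcup_(i in [set: idx (s k)]) `]lft (s k) i, rgt (s k) i]%classic in
  (forall k, nu (~` T k) = 0%E) /\ (energy nu <= E%:E)%E.
Proof.
move=> hnu hrad hE T.
have mB k i : measurable (`]lft (s k) i, rgt (s k) i]%classic : set R) by exact: measurable_itv.
have mT k : measurable (T k) by apply: fin_bigcup_measurable => //; exact: finite_finset.
have T0 k : nu (~` T k) = 0%E.
  have disj i j z : `]lft (s k) i, rgt (s k) i]%classic z ->
      `]lft (s k) j, rgt (s k) j]%classic z -> i = j.
    rewrite /= !in_itv/= => /andP[z1 z2] /andP[z3 z4].
    apply/eqP/negPn/negP => /lft_rgt_disjoint[h|h].
      by have := lt_trans (le_lt_trans z2 h) z3; rewrite ltxx.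
    by have := lt_trans (le_lt_trans z4 h) z1; rewrite ltxx.
  have nT : nu (T k) = 1%E.
    by rewrite (measure_disjoint_bigcup nu (wt (s k)))// wt_sum.
  by rewrite probability_setC// nT subee.
split => //.
pose K := \bigcap_k T k.
have mK : measurable K by exact: bigcapT_measurable.
have nK : nu (~` K) = 0%E.
  apply/negligibleP; first exact: measurableC.
  rewrite /K setC_bigcap; apply: negligible_bigcup => k.
  by apply/negligibleP; [exact: measurableC|exact: T0].
have K01 : K `<=` `[0%R, 1%R].
  move=> x /(_ 0%N I)[i _]; rewrite /= !in_itv/= /lft /rgt => /andP[? ?].
  have := left_ge0 R (s 0%N) i; have := right_le1 R (s 0%N) i.
  by move=> ? ?; apply/andP; split; lra.
have zw1 z w : K z -> K w -> `|z - w| <= 1.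
  move=> /K01 + /K01; rewrite /= !in_itv/= => /andP[? ?] /andP[? ?].
  by rewrite ler_norml; apply/andP; split; lra.
have liminf z w : K z -> K w -> (logk z w <= limn_einf (fun k => (cell_energy (s k) z w)%:E))%E.
  move=> Kz Kw; have [zw|zw] := eqVneq z w.
    rewrite {1}/logk zw eqxx leye_eq; apply/eqP/eq_infty => r.
    (* A radius below exp(10 - r) makes the diagonal value 10 - ln(rad) at least r, so the step
       kernels tend to +oo on the diagonal. *)
    have [N HN] := hrad (expR (10 - r)) (expR_gt0 _).
    apply: (@le_limn_einf _ _ _ N) => k Nk; have [i _ wi] := Kw k I.
    rewrite lee_fin; apply: le_trans (cell_energy_ge _ _ _ _ _ wi wi).
    rewrite /pair_energy eqxx.
    have : ln (rad (s k) i) <= ln (expR (10 - r)).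
      by rewrite ler_ln ?posrE ?expR_gt0 ?rad_gt0//; exact/ltW/HN.
    by rewrite expRK; lra.
  have d0 : 0 < `|z - w| / 2 by rewrite divr_gt0// normr_gt0 subr_eq0.
  have [N HN] := hrad _ d0.
  apply: (@le_limn_einf _ _ _ N) => k Nk; have [i _ zi] := Kz k I; have [j _ wj] := Kw k I.
  by apply: (logk_le_cell_energy _ i j) => // l; have := HN k Nk l; lra.
pose h k w : R := \sum_j (\sum_i pair_energy (ctr (s k)) (rad (s k)) i j * wt (s k) i) *
   \1_(`]lft (s k) j, rgt (s k) j]) w.
have hI k w : (\int[nu]_z (cell_energy (s k) z w)%:E = (h k w)%:E)%E.
  have [+ _] := integral_step_kernel nu (wt (s k)) _ _ (mB k) (hnu k) (pair_energy_ge0 (s k)).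
  by apply.
have hII k : (\int[nu]_w (h k w)%:E = (cenergy (s k))%:E)%E.
  by have [_] := integral_step_kernel nu (wt (s k)) _ _ (mB k) (hnu k) (pair_energy_ge0 (s k)).
have h0 k w : 0 <= h k w.
  apply: sumr_ge0 => j _; rewrite mulr_ge0//; apply: sumr_ge0 => i _.
  by rewrite mulr_ge0 ?pair_energy_ge0//; exact/ltW/wt_gt0.
have mh k : measurable_fun setT (fun w => (h k w)%:E).
  apply/measurable_EFinP; apply: measurable_sum => i.
  by apply: measurable_funM => //; apply: measurable_indic.
have g0 k z w : (0 <= (cell_energy (s k) z w)%:E)%E by rewrite lee_fin cell_energy_ge0.
have lim0 (u : (\bar R)^nat) : (forall k, 0 <= u k)%E -> (0 <= limn_einf u)%E.
  by move=> u0; apply: (@le_limn_einf _ _ _ 0%N).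
have inner w : K w -> (\int[nu]_z logkp z w <= limn_einf (fun k => (h k w)%:E))%E.
  move=> Kw.
  rewrite (_ : (fun k => (h k w)%:E) = (fun k => \int[nu]_z (cell_energy (s k) z w)%:E)%E);
    last by apply/funext => k; rewrite hI.
  apply: le_trans (fatou nu measurableT (fun k => measurable_cell_energy (s k) w)
    (fun k z _ => g0 k z w)).
  apply: ae_ge0_le_integral => //.
  - by move=> z _; exact: logkp_ge0.
  - exact: measurable_logkp_l.
  - by move=> z _; apply: lim0.
  - by apply: measurable_limn_einf => k; exact: measurable_cell_energy.
  exists (~` K); split => //; first exact: measurableC.
  by apply: subsetC => z Kz _; rewrite logkE ?zw1//; exact: liminf.
rewrite (energy_logkp nu K)//.
apply: (@le_trans _ _ (\int[nu]_w limn_einf (fun k => (h k w)%:E))%E).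
  apply: ae_ge0_le_integral => //.
  - by move=> w _; apply: integral_ge0 => z _; exact: logkp_ge0.
  - by apply: (measurable_integral_kernel nu _ measurable_logkp) => x; exact: logkp_ge0.
  - by move=> w _; apply: lim0 => k; rewrite lee_fin.
  - exact: measurable_limn_einf.
  exists (~` K); split => //; first exact: measurableC.
  by apply: subsetC => w Kw _; exact: inner.
apply: le_trans (fatou nu measurableT mh _) _; first by move=> k w _; rewrite lee_fin.
by apply: limn_einf_le => k; rewrite hII lee_fin.
Qed.

(** * Approximating a measure by a cluster *)

(** Cells are open on the left except the first, which contains 0, so that they partition [0,1]. *)
Definition grid_cell {R : realType} (M u : nat) : set R :=
  [set` Interval (BSide (u == 0%N) (u%:R / M%:R)) (BRight (u.+1%:R / M%:R))].

Lemma grid_cell_bounds {R : realType} (M u : nat) (x : R) : grid_cell M u x ->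
  u%:R / M%:R <= x <= u.+1%:R / M%:R.
Proof. by rewrite /grid_cell /= in_itv/= => /andP[/lteifW -> ->]. Qed.

Lemma grid_cell_inj {R : realType} (M u v : nat) (x : R) :
  grid_cell M u x -> grid_cell M v x -> u = v.
Proof.
wlog uv : u v / (u < v)%N => [H h1 h2|/grid_cell_bounds/andP[_ h1]].
  by have [uv|vu|//] := ltngtP u v; [|symmetry]; apply: H.
rewrite /grid_cell /= in_itv/= (gtn_eqF (leq_ltn_trans (leq0n u) uv))/= => /andP[h2 _].
have : u.+1%:R / M%:R <= v%:R / M%:R :> R by rewrite ler_wpM2r ?invr_ge0// ler_nat.
by move=> h; have := le_lt_trans (le_trans h1 h) h2; rewrite ltxx.
Qed.

Lemma grid_cell_cover {R : realType} (M : nat) : (0 < M)%N ->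
  \bigcup_(u in [set: 'I_M]) (grid_cell M u : set R) = `[0, 1]%classic.
Proof.
move=> M0; have M0' : 0 < M%:R :> R by rewrite ltr0n.
apply/seteqP; split => x.
  move=> [u _ /grid_cell_bounds/andP[h1 h2]]; rewrite /= in_itv/=; apply/andP; split.
    by apply: le_trans h1; rewrite divr_ge0.
  by apply: le_trans h2 _; rewrite ler_pdivrMr// mul1r ler_nat.
rewrite /= in_itv/= => /andP[x0 x1].
have ex : exists u, x <= u.+1%:R / M%:R.
  by exists M.-1; rewrite prednK// divff// gt_eqF.
have [u hu umin] := ex_minnP ex.
have uM : (u < M)%N.
  by rewrite -[M]prednK// ltnS; apply: umin; rewrite prednK// divff// gt_eqF.
exists (Ordinal uM) => //; rewrite /grid_cell /= in_itv/= hu andbT.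
case: u hu umin {uM} => [|u] hu umin /=; first by rewrite mul0r.
by rewrite ltNge; apply/negP => /umin; rewrite ltnn.
Qed.

Definition grid_ctr {R : realType} (M : nat) (u : 'I_M) : R := (u%:R + 2^-1) / M%:R.
(** A quarter of the cell width: neighboring balls stay 1/(2M) apart, and their pair energy is ln M
    + O(1). *)
Definition grid_rad {R : realType} (M : nat) (u : 'I_M) : R := (4 * M%:R)^-1.

Lemma grid_ctr_dist {R : realType} (M : nat) (u v : 'I_M) :
  `|grid_ctr M u - grid_ctr M v| = (ndist u v)%:R / M%:R :> R.
Proof.
rewrite /grid_ctr -mulrBl normrM (@ger0_norm _ (M%:R^-1)) ?invr_ge0//; congr (_ * _).
have [uv|vu] := leqP u v.
  rewrite (_ : ndist u v = (v - u)%N) ?natrB//; last by rewrite /ndist; lia.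
  by rewrite ler0_norm; [ring|rewrite opprD addrACA subrr addr0 subr_le0 ler_nat].
have vu' := ltnW vu; rewrite (_ : ndist u v = (u - v)%N) ?natrB//; last by rewrite /ndist; lia.
by rewrite ger0_norm; [ring|rewrite opprD addrACA subrr addr0 subr_ge0 ler_nat].
Qed.

Lemma ler1_ndist {R : realType} (M : nat) (u v : 'I_M) : u != v -> 1 <= (ndist u v)%:R :> R.
Proof. by rewrite ler1n /ndist -(inj_eq val_inj)/=; lia. Qed.

Lemma grid_pair_energyE {R : realType} (M : nat) (u v : 'I_M) : (0 < M)%N ->
  pair_energy (grid_ctr M) (grid_rad M) u v =
  if u == v then 10 + ln 4 + ln M%:R else ln M%:R - ln ((ndist u v)%:R - 2^-1) :> R.
Proof.
move=> M0; have M0' : 0 < M%:R :> R by rewrite ltr0n.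
rewrite /pair_energy; case: eqVneq => uv.
  by rewrite /grid_rad lnV ?posrE ?mulr_gt0// lnM ?posrE//; ring.
have d1 : 1 <= (ndist u v)%:R :> R.
  exact: ler1_ndist.
rewrite grid_ctr_dist /grid_rad.
have -> : (ndist u v)%:R / M%:R - (4 * M%:R)^-1 - (4 * M%:R)^-1 =
    ((ndist u v)%:R - 2^-1) / M%:R :> R by field; rewrite gt_eqF.
by rewrite ln_div ?posrE//; [ring|lra].
Qed.

Lemma grid_dist_le {R : realType} (M u v : nat) (x y : R) : (0 < M)%N ->
  grid_cell M u x -> grid_cell M v y -> `|x - y| <= ((ndist u v)%:R + 1) / M%:R.
Proof.
move=> M0; have M0' : 0 < M%:R :> R by rewrite ltr0n.
wlog uv : u v x y / (u <= v)%N => [H h1 h2|].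
  have [uv|vu] := leqP u v; first exact: H.
  by rewrite distrC (_ : ndist u v = ndist v u) ?H// 1?ltnW// /ndist addnC.
move=> /grid_cell_bounds/andP[h1 h2] /grid_cell_bounds/andP[h3 h4].
have -> : ndist u v = (v - u)%N by rewrite /ndist; lia.
rewrite natrB// ler_pdivlMr// -[_ * M%:R]ger0_norm ?mulr_ge0// normrM normr_id.
rewrite -normrM ler_norml.
move: h1 h2 h3 h4; rewrite !ler_pdivrMr// !ler_pdivlMr// -[u.+1%:R]natr1 -[v.+1%:R]natr1.
have : (u%:R <= v%:R :> R) by rewrite ler_nat.
by move=> ? ? ? ? ?; apply/andP; split; lra.
Qed.

(* Far cells: the kernel varies by at most e. Near cells: both sides are
   log M + O(1), and O(1) is at most e log M for M large. *)
Lemma grid_pair_energy_le {R : realType} (e : R) : 0 < e -> exists2 M : nat, (0 < M)%N &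
  forall (u v : 'I_M) (x y : R), grid_cell M u x -> grid_cell M v y ->
  ((pair_energy (grid_ctr M) (grid_rad M) u v)%:E <= (1 + e)%:E * logkp x y + e%:E)%E.
Proof.
(* For index distances d >= L, ln(d + 1) - ln(d - 1/2) is at most e. *)
move=> e0; pose L := (Num.truncn (2 / e)).+2.
have L0 : 0 < L%:R :> R by rewrite ltr0n.
have Le : 2 / e + 1 <= L%:R.
  by rewrite -[L%:R]natr1 lerD2r ltW// truncnS_gt.
(* Near cells lose at most ln L in the kernel and at most 10 + ln 4 <= 13 in the pair energy; M is
   chosen so that e (ln M - ln L) covers both. *)
pose H : R := 14 + ln L%:R.
pose M := (Num.truncn (expR (H / e + ln L%:R))).+1.
have M0' : 0 < M%:R :> R by rewrite ltr0n.
have HM : H <= e * (ln M%:R - ln L%:R).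
  rewrite mulrC -ler_pdivrMr// lerBrDr -ler_expR lnK ?posrE//.
  exact/ltW/truncnS_gt.
exists M => // u v x y xu yv.
have [xy|xy] := eqVneq x y.
  by rewrite /logkp /logk xy eqxx maxye gt0_muley ?lte_fin ?addr_gt0// addye// leey.
have x01 : `[0, 1]%classic x by rewrite -(@grid_cell_cover R M)//; exists u.
have y01 : `[0, 1]%classic y by rewrite -(@grid_cell_cover R M)//; exists v.
have xy1 : `|x - y| <= 1.
  move: x01 y01; rewrite /= !in_itv/= => /andP[? ?] /andP[? ?].
  by rewrite ler_norml; apply/andP; split; lra.
rewrite logkE// /logk (negPf xy) -EFinM -EFinD lee_fin.
have a0 : 0 < `|x - y| by rewrite normr_gt0 subr_eq0.
have la : 0 <= - ln `|x - y| by rewrite oppr_ge0 ln_le0.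
set d : R := (ndist u v)%:R.
have d0 : 0 <= d by [].
have hln : ln M%:R - ln (d + 1) <= - ln `|x - y|.
  rewrite -[leLHS]opprB -ln_div ?posrE//; last lra.
  by apply: ler_Nln => //; exact: grid_dist_le.
have e_la : 0 <= e * - ln `|x - y| by rewrite mulr_ge0// ltW.
have ln4 : ln 4 <= 3 :> R by have := @ln_le_subr1 R 4; rewrite ltr0n => /(_ isT); lra.
rewrite grid_pair_energyE// -/d.
have [dL|dL] := leP L%:R d.
  have e0' : 0 < 2 / e by rewrite divr_gt0.
  have uv : u != v by apply/eqP => uv; move: dL; rewrite /d uv /ndist subnn; lra.
  rewrite (negPf uv).
  have h1 : ln (d + 1) - ln (d - 2^-1) <= e.
    rewrite -ln_div ?posrE; [|lra|lra].
    apply: le_trans (ln_le_subr1 _ (_ : 0 < _)) _; first by rewrite divr_gt0; lra.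
    rewrite lerBlDr ler_pdivrMr; last lra.
    have h2 : 2 / e * e = 2 by rewrite mulfVK// gt_eqF.
    have : (2 / e) * e <= (d - 1) * e by rewrite ler_wpM2r ?(ltW e0)//; lra.
    by rewrite h2; nra.
  by lra.
have dL1 : d + 1 <= L%:R by rewrite natr1 ler_nat -(ltr_nat R).
have h1 : ln M%:R - ln L%:R <= - ln `|x - y|.
  by apply: le_trans hln; rewrite lerD2l lerN2 ler_ln ?posrE//; lra.
have h2 : e * (ln M%:R - ln L%:R) <= e * - ln `|x - y| by rewrite ler_wpM2l// ltW.
have -> : (1 + e) * - ln `|x - y| + e = - ln `|x - y| + e * - ln `|x - y| + e by ring.
apply: (@le_trans _ _ (ln M%:R + 13)); last by rewrite /H in HM; lra.
case: ifPn => [_|uv]; first by lra.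
have d1 : 1 <= d by exact: ler1_ndist.
have : - ln (d - 2^-1) <= - ln 2^-1 by apply: ler_Nln => //; lra.
by rewrite lnV ?posrE//; have := @ln_le_subr1 R 2; rewrite ltr0n => /(_ isT); lra.
Qed.

Lemma grid_pair_energy_ge0 {R : realType} (M : nat) (u v : 'I_M) : (0 < M)%N ->
  0 <= pair_energy (grid_ctr M) (grid_rad M) u v :> R.
Proof.
move=> M0; have M0' : 1 <= M%:R :> R by rewrite ler1n.
rewrite grid_pair_energyE//; case: ifPn => uv.
  by rewrite !addr_ge0// ln_ge0//; lra.
have uM := ltn_ord u; have vM := ltn_ord v.
have d1 : 1 <= (ndist u v)%:R :> R.
  exact: ler1_ndist.
have dM : (ndist u v)%:R <= M%:R :> R by rewrite ler_nat /ndist; lia.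
by rewrite subr_ge0 ler_ln ?posrE; lra.
Qed.

(** Each grid ball receives the mass that [mu] gives to its cell. The energy is then the integral of
    a step kernel that [grid_pair_energy_le] bounds by (1 + e) times the logarithmic kernel plus
    e. *)
Lemma exists_initial_cluster {R : realType} (mu : probability R R) (E e : R) :
  mu (~` `[0%R, 1%R]%classic) = 0%E -> energy mu = E%:E -> 0 < e ->
  exists s : cluster R, cenergy s <= (1 + e) * E + e.
Proof.
move=> mu01 muE e0; have [M M0 HM] := grid_pair_energy_le e e0.
have M0' : 0 < M%:R :> R by rewrite ltr0n.
pose J (u : 'I_M) : set R := grid_cell M u.
have mJ u : measurable (J u) by exact: measurable_itv.
pose w u := fine (mu (J u)).
have wE u : mu (J u) = (w u)%:E by rewrite fineK// fin_num_measure.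
have disj i j z : J i z -> J j z -> i = j.
  by move=> hi hj; apply: ord_inj; exact: grid_cell_inj hi hj.
have w1 : \sum_u w u = 1.
  have := measure_disjoint_bigcup mu w J mJ wE disj; rewrite grid_cell_cover//.
  have -> : mu `[0%R, 1%R]%classic = 1%E.
    rewrite -[X in mu X]setCK probability_setC ?mu01 ?sube0//.
    by apply: measurableC; exact: measurable_itv.
  by move=> [].
have w0 u : 0 <= w u by exact: fine_ge0.
have [||s [_ sE]] := cluster_of_weights 'I_M (grid_ctr M) (grid_rad M) w w0 w1.
- move=> u _; rewrite /grid_rad /grid_ctr; split; first by rewrite invr_gt0 mulr_gt0.
    have -> : (u%:R + 2^-1) / M%:R - (4 * M%:R)^-1 = (u%:R + 4^-1) / M%:R :> R.
      by field; rewrite gt_eqF.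
    by rewrite divr_ge0.
  have -> : (u%:R + 2^-1) / M%:R + (4 * M%:R)^-1 = (u%:R + 3 / 4) / M%:R :> R.
    by field; rewrite gt_eqF.
  rewrite ler_pdivrMr// mul1r; apply: (@le_trans _ _ (u.+1%:R)); last by rewrite ler_nat.
  by rewrite -natr1; lra.
- move=> u v _ _ uv; rewrite grid_ctr_dist /grid_rad.
  have d1 : 1 <= (ndist u v)%:R :> R.
    exact: ler1_ndist.
  rewrite ltr_pdivlMr//.
  have -> : ((4 * M%:R)^-1 + (4 * M%:R)^-1) * M%:R = 2^-1 :> R by field; rewrite gt_eqF.
  by lra.
exists s; rewrite sE.
pose g (i j : 'I_M) : R := pair_energy (grid_ctr M) (grid_rad M) i j.
have g0 i j : 0 <= g i j by exact: grid_pair_energy_ge0.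
have [inner outer] := integral_step_kernel mu w J g mJ wE g0.
pose h z y : R := \sum_i \sum_j g i j * (\1_(J i) z * \1_(J j) y).
have rhs0 z y : (0 <= (1 + e)%:E * logkp z y + e%:E)%E.
  by rewrite adde_ge0 ?mule_ge0 ?logkp_ge0 ?lee_fin ?addr_ge0 ?ltW.
have h_le z y : ((h z y)%:E <= (1 + e)%:E * logkp z y + e%:E)%E.
  have [[i zi]|nz] := pselect (exists i, J i z); last first.
    rewrite /h big1// => i _; rewrite big1// => j _.
    by rewrite (_ : \1_(J i) z = 0) ?mul0r ?mulr0// indicE memNset// => zi; apply: nz; exists i.
  have [[j yj]|ny] := pselect (exists j, J j y); last first.
    rewrite /h big1// => k _; rewrite big1// => j _.
    by rewrite (_ : \1_(J j) y = 0) ?mulr0// indicE memNset// => yj; apply: ny; exists j.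
  apply: le_trans (HM i j z y zi yj); rewrite lee_fin /h (bigD1 i)//= (bigD1 j)//=.
  rewrite !indicE !mem_set// !mulr1 big1 ?addr0; last first.
    move=> k kj; rewrite (_ : \1_(J k) y = 0) ?mulr0// indicE memNset// => yk.
    by move/eqP: kj; apply; exact: disj yk yj.
  rewrite big1 ?addr0// => k ki; rewrite big1// => l _.
  rewrite (_ : \1_(J k) z = 0) ?mul0r ?mulr0// indicE memNset// => zk.
  by move/eqP: ki; apply; exact: disj zk zi.
pose P y := (\int[mu]_z logkp z y)%E.
have P0 y : (0 <= P y)%E by apply: integral_ge0 => z _; exact: logkp_ge0.
have mP : measurable_fun setT P.
  by apply: (measurable_integral_kernel mu _ measurable_logkp) => x; exact: logkp_ge0.
have lin (f : R -> \bar R) : measurable_fun setT f -> (forall z, (0 <= f z)%E) ->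
    (\int[mu]_z ((1 + e)%:E * f z + e%:E) = (1 + e)%:E * (\int[mu]_z f z) + e%:E)%E.
  move=> mf f0; have e1 : (0 <= (1 + e)%:E :> \bar R)%E by rewrite lee_fin addr_ge0 ?ltW.
  rewrite ge0_integralD//; last 3 first.
  - by move=> z _; rewrite mule_ge0.
  - exact: measurable_funeM.
  - by move=> z _; rewrite lee_fin ltW.
  rewrite ge0_integralZl//; congr (_ + _)%E.
  rewrite integral_cst// -[RHS]mule1; congr (_ * _)%E; exact: probability_setT.
have mh y : measurable_fun setT (fun z => (h z y)%:E).
  apply/measurable_EFinP; apply: measurable_sum => i; apply: measurable_sum => j.
  by apply: measurable_funM => //; apply: measurable_funM => //; apply: measurable_indic.
have h0 z y : 0 <= h z y.
  by apply: sumr_ge0 => i _; apply: sumr_ge0 => j _; rewrite mulr_ge0.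
have step1 y : ((\sum_j (\sum_i g i j * w i) * \1_(J j) y)%:E <= (1 + e)%:E * P y + e%:E)%E.
  rewrite -inner -lin//; [|exact: measurable_logkp_l|by move=> z; exact: logkp_ge0].
  apply: ge0_le_integral => //.
  - by move=> z _; rewrite lee_fin; exact: h0.
  - exact: mh.
  - apply: emeasurable_funD => //; apply: measurable_funeM; exact: measurable_logkp_l.
  - by move=> z _; exact: h_le.
rewrite -lee_fin -outer EFinD EFinM -muE (energy_logkp mu `[0%R, 1%R]%classic)// -lin//.
apply: ge0_le_integral => //.
- move=> y _; rewrite lee_fin; apply: sumr_ge0 => j _; rewrite mulr_ge0//.
  by apply: sumr_ge0 => i _; rewrite mulr_ge0.
- apply/measurable_EFinP; apply: measurable_sum => j.
  by apply: measurable_funM => //; apply: measurable_indic.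
- by apply: emeasurable_funD => //; exact: measurable_funeM.
Qed.

(** * Capacity of the limsup set *)

Lemma limsup_set_sub01 {R : realType} (lambda : R) (c : nat -> R) : 0 < lambda ->
  (forall k : nat, (1 <= k)%N -> 0 < c k < 1) -> limsup_set lambda c `<=` `[0%R, 1%R].
Proof.
move=> la0 c01 x Sx.
have h e : 0 < e -> - e <= x <= 1 + e.
  move=> e0; have [N HN] := len_cvg0 _ _ la0 e0.
  have [//|k /= Nk] := Sx N.+1; rewrite in_itv/= => /andP[h1 h2].
  have /andP[c0 c1] := c01 k (leq_ltn_trans (leq0n N) Nk).
  have := HN k (ltnW Nk); have := len_gt0 lambda k.
  by move=> ? ?; apply/andP; split; lra.
rewrite /= in_itv/=; apply/andP; split; rewrite leNgt; apply/negP => hx.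
  have e0 : 0 < - x / 2 by lra.
  by have /andP[? _] := h _ e0; lra.
have e0 : 0 < (x - 1) / 2 by lra.
by have /andP[_ ?] := h _ e0; lra.
Qed.

(** The energy bound of [exists_subcluster] is exactly what [graft] requires in each ball. *)
Lemma exists_refinement {R : realType} (lambda : R) (c : nat -> R) (q : nat -> nat) :
  0 < lambda -> (forall k : nat, (1 <= k)%N -> 0 < c k < 1) -> assumption_A1 c ->
  (forall M : nat, exists N : nat, forall n, (N <= n)%N -> (M <= q n)%N) ->
  assumption_A2 c q -> assumption_A3 lambda c q ->
  forall (m : nat) (s : cluster R), exists (t : cluster R) (p : idx t -> idx s),
    [/\ refines p, cenergy t <= cenergy s &
        forall k, exists2 j, (m <= j)%N & ctr t k = c j /\ rad t k = len lambda j / 4].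
Proof.
move=> la0 c01 A1 qoo A2 A3 m s.
have [ch Hch] := choice (fun i : idx s => exists_subcluster lambda c q _ _ m la0 c01 qoo A2 A3
  (rad_gt0 R s i) (left_ge0 R s i) (right_le1 R s i)
  (A1_has_cell_weights c _ _ A1 (rad_gt0 R s i) (left_ge0 R s i) (right_le1 R s i))).
have [||t [p [rp en bl]]] := graft s ch.
- by move=> i; have [] := Hch i.
- by move=> i; have [] := Hch i.
exists t, p; split => // k; have [i [k' [-> ->]]] := bl k.
by have [_ /(_ k')] := Hch i.
Qed.

Lemma exists_measure_on_limsup {R : realType} (lambda : R) (c : nat -> R) (q : nat -> nat)
    (s0 : cluster R) :
  0 < lambda -> (forall k : nat, (1 <= k)%N -> 0 < c k < 1) -> assumption_A1 c ->
  (forall M : nat, exists N : nat, forall n, (N <= n)%N -> (M <= q n)%N) ->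
  assumption_A2 c q -> assumption_A3 lambda c q ->
  exists2 nu : probability R R, compactly_supported_in (limsup_set lambda c) nu &
    (energy nu <= (cenergy s0)%:E)%E.
Proof.
move=> la0 c01 A1 qoo A2 A3.
have step := exists_refinement lambda c q la0 c01 A1 qoo A2 A3.
pose f m := projT1 (choice (step m)); have Hf m := projT2 (choice (step m)).
(* Stage k+1 consists of shrunk intervals of index at least k; stage 0 is arbitrary. *)
pose st := fix st k := if k is k'.+1 then f k' (st k') else s0.
pose p k := projT1 (cid (Hf k (st k))).
have rp k : refines (p k : idx (st k.+1) -> idx (st k)).
  by rewrite /p; case: cid => /= ? [].
have en k : cenergy (st k.+1) <= cenergy (st k).
  by case: (Hf k (st k)) => /= ? [].
have bl k (i : idx (st k.+1)) :
    exists2 j, (k <= j)%N & ctr (st k.+1) i = c j /\ rad (st k.+1) i = len lambda j / 4.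
  by case: (Hf k (st k)) => /= ? [_ _]; exact.
have en0 k : cenergy (st k) <= cenergy s0.
  by elim: k => [//|k]; exact: le_trans (en k).
have hrad e : 0 < e -> exists N, forall k, (N <= k)%N -> forall i, rad (st k) i < e.
  move=> e0; have [N HN] := len_cvg0 _ _ la0 e0; exists N.+1 => -[//|k] Nk i.
  have [j kj [_ ->]] := bl k i; have := HN j (leq_trans (Nk : (N <= k)%N) kj); have := len_gt0 lambda j.
  by lra.
have [nu hnu] := exists_limit_probability st p rp.
have [nuT nuE] := energy_limit_le st nu _ hnu hrad en0.
exists nu => //.
(* Closed balls are used in place of half-open intervals to make K compact; they contain the sets of
   full measure found above. *)
pose B k (i : idx (st k)) : set R := `[lft (st k) i, rgt (st k) i]%classic.
pose K := \bigcap_k \bigcup_(i in [set: idx (st k)]) B k i.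
have cK : closed K.
  apply: closed_bigI => k _; apply: closed_bigcup; first exact: finite_finset.
  by move=> i _; exact: itv_closed.
have K01 : K `<=` `[0%R, 1%R].
  move=> x /(_ 0%N I)[i _]; rewrite /B /= !in_itv/= /lft /rgt => /andP[? ?].
  have := left_ge0 R s0 i; have := right_le1 R s0 i.
  by move=> ? ?; apply/andP; split; lra.
exists K; split.
- exact: (subclosed_compact cK (@segment_compact _ 0 1)).
(* A closed ball of stage m+1 has radius [len lambda j / 4] with j >= m, so it lies in the open
   interval I_j, of half-length [len lambda j / 2]. *)
- move=> x Kx m /= m1; have [i _] := Kx m.+1 I.
  rewrite /B /= in_itv/= /lft /rgt; have [j mj [-> ->]] := bl m i => /andP[h1 h2].
  exists j => //=; rewrite in_itv/=; have := len_gt0 lambda j.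
  by move=> ?; apply/andP; split; lra.
apply/negligibleP; first by apply: measurableC; exact: closed_measurable.
rewrite /K setC_bigcap; apply: negligible_bigcup => k.
apply: negligibleS; last first.
  apply/negligibleP; last exact: (nuT k).
  apply: measurableC; apply: fin_bigcup_measurable; first exact: finite_finset.
  by move=> i _; exact: measurable_itv.
apply: subsetC => x [i _ xi]; exists i => //; move: xi; rewrite /B /= !in_itv/=.
by move=> /andP[/ltW -> ->].
Qed.

(** One ball filling [0,1] already starts the construction; the resulting measure of finite energy
    gives positive capacity. *)
Lemma inhabited_cluster (R : realType) : inhabited (cluster R).
Proof.
have [||||s _] := cluster_of_weights unit (fun=> 2^-1) (fun=> 2^-1 : R) (fun=> 1).
- by move=> _; exact: ler01.
- by rewrite sumr_const card_unit.
- by move=> _ _; split; lra.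
- by move=> [] [].
by constructor.
Qed.

Theorem theorem1p7 (R : realType) (lambda : R) (c : nat -> R) :
  0 < lambda ->
  (forall k : nat, (1 <= k)%N -> 0 < c k < 1) ->
  assumption_A1 c ->
  (exists q : nat -> nat,
     (forall M : nat, exists N : nat, forall n, (N <= n)%N -> (M <= q n)%N) /\
     assumption_A2 c q /\ assumption_A3 lambda c q) ->
  capacity (limsup_set lambda c) = capacity (`[0, 1] : set R) /\
  (0 < capacity (`[0%R, 1%R] : set R))%E.
Proof.
move=> la0 c01 A1 [q [qoo [A2 A3]]].
have main s := exists_measure_on_limsup lambda c q s la0 c01 A1 qoo A2 A3.
have S01 := limsup_set_sub01 lambda c la0 c01.
pose inf_energy (E : set R) :=
  ereal_inf [set energy mu | mu in [set mu | compactly_supported_in E mu]].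
have le_inf : (inf_energy `[0%R, 1%R]%classic <= inf_energy (limsup_set lambda c))%E.
  apply: ereal_inf_le_tmp => _ [mu [K [cK KS K0]] <-]; exists mu => //.
  by exists K; split => //; exact: subset_trans KS S01.
have carried (mu : probability R R) : compactly_supported_in `[0%R, 1%R]%classic mu ->
    mu (~` `[0%R, 1%R]%classic) = 0%E.
  move=> [K [cK K01 K0]]; apply: (subset_measure0 _ _ _ K0); last exact: subsetC.
  - by apply: measurableC; exact: measurable_itv.
  - by apply: measurableC; exact: compact_measurable.
have ge_inf : (inf_energy (limsup_set lambda c) <= inf_energy `[0%R, 1%R]%classic)%E.
  apply: le_ereal_inf_tmp => _ [mu hmu <-].
  have mu01 := carried mu hmu.
  have mu0 : (0 <= energy mu)%E.
    rewrite (energy_logkp mu `[0%R, 1%R]%classic)//.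
    by apply: integral_ge0 => w _; apply: integral_ge0 => z _; exact: logkp_ge0.
  move: mu0; case muE : (energy mu) => [E| |]; [|by move=> _; rewrite leey|by []].
  rewrite lee_fin => E0; apply/lee_addgt0Pr => e e0.
  (* With e' = e/(E + 1), the bound (1 + e') E + e' equals E + e. *)
  have e0' : 0 < e / (E + 1) by rewrite divr_gt0//; lra.
  have [s sE] := exists_initial_cluster mu E _ mu01 muE e0'.
  have [nu hnu nuE] := main s.
  apply: le_trans (_ : energy nu <= _)%E; first by apply: ereal_inf_lbound; exists nu.
  apply: le_trans nuE _; rewrite -EFinD lee_fin; apply: le_trans sE _.
  by rewrite le_eqVlt; apply/orP; left; apply/eqP; field; rewrite gt_eqF//; lra.
have inf_eq : inf_energy (limsup_set lambda c) = inf_energy `[0%R, 1%R]%classic.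
  by apply/eqP; rewrite eq_le le_inf ge_inf.
split; first by rewrite /capacity -/(inf_energy _) -/(inf_energy _) inf_eq.
have [s] := inhabited_cluster R; have [nu hnu nuE] := main s.
have : (inf_energy (limsup_set lambda c) < +oo)%E.
  by apply: le_lt_trans (ltry (cenergy s)); apply: le_trans nuE; apply: ereal_inf_lbound; exists nu.
rewrite inf_eq /capacity -/(inf_energy _); case: (inf_energy `[0%R, 1%R]%classic) => [r _| |_] //.
by rewrite lte_fin expR_gt0.
Qed.
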